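(* Let $N\ge1$ and let $\psi$ be an Orlicz function satisfying the $\Delta^2$-Condition. Then for every $\zeta\in\mathbb{S}_N$ and every $b>1$ there exists a holomorphic map $\phi:\mathbb{B}_N\to\mathbb{B}_N$ with $\phi(\mathbb{B}_N)\subset\Gamma(\zeta,b)$ such that the composition operator $C_\phi$ is not compact on $H^\psi(\mathbb{B}_N)$.
   Context: $\mathbb{B}_N$ is the open unit ball of $\mathbb{C}^N$, $\mathbb{S}_N$ its boundary sphere with normalized invariant measure $\sigma_N$, $\langle z,w\rangle=\sum_i z_i\overline{w_i}$. For $\zeta\in\mathbb{S}_N$ and $a>1$, the Korányi approach region is $\Gamma(\zeta,a)=\{z\in\mathbb{B}_N:|1-\langle z,\zeta\rangle|<\frac a2(1-|z|^2)\}$. $C_\phi f=f\circ\phi$. An Orlicz function is a strictly convex $\psi:[0,\infty)\to[0,\infty)$ with $\psi(0)=0$, continuous at $0$, and $\psi(x)/x\to\infty$. $\psi$ satisfies the $\Delta^2$-Condition if there exist $C>0$ and $x_0>0$ with $\psi(x)^2\le\psi(Cx)$ for all $x\ge x_0$. The Hardy–Orlicz space $H^\psi(\mathbb{B}_N)$ is the Banach space of holomorphic $f$ on $\mathbb{B}_N$ with $\sup_{0<r<1}\|f_r\|_\psi<\infty$, where $f_r(\zeta)=f(r\zeta)$ and $\|h\|_\psi=\inf\{C>0:\int_{\mathbb{S}_N}\psi(|h|/C)\,d\sigma_N\le1\}$ is the Luxemburg norm. *)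

(* Defs.v *)
From HB Require Import structures.
From mathcomp Require Import all_boot all_order all_algebra.
From mathcomp Require Import all_classical all_reals all_analysis.
From mathcomp Require Import complex.
Set Implicit Arguments. Unset Strict Implicit. Unset Printing Implicit Defensive.
Import Order.TTheory GRing.Theory Num.Theory.
Import numFieldNormedType.Exports.
Local Open Scope classical_set_scope.
Local Open Scope ring_scope.

Section Defs.
Variable R : realType.
Local Notation C := (complex.complex R).

Definition cabs (z : C) : R :=
  Num.sqrt (complex.Re z ^+ 2 + complex.Im z ^+ 2).

Definition cvec (N : nat) := 'I_N -> C.

Definition cadd N (z w : cvec N) : cvec N := fun i => z i + w i.
Definition rscale N (r : R) (z : cvec N) : cvec N := fun i => complex.Complex r 0 * z i.

Definition cdot N (z w : cvec N) : C := \sum_(i < N) z i * complex.conjc (w i).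

Definition cnorm N (z : cvec N) : R :=
  Num.sqrt (\sum_(i < N) (complex.Re (z i) ^+ 2 + complex.Im (z i) ^+ 2)).

Definition koranyi N (zeta : cvec N) (a : R) (z : cvec N) : Prop :=
  cnorm z < 1 /\
  cabs (1 - cdot z zeta) < a / 2 * (1 - cnorm z ^+ 2).

Definition holo_on_ball N (f : cvec N -> C) : Prop :=
  forall z : cvec N, cnorm z < 1 ->
  exists a : 'I_N -> C, forall e : R, 0 < e -> exists d : R, 0 < d /\
    forall h : cvec N, cnorm h < d ->
      cabs (f (cadd z h) - f z - \sum_(i < N) a i * h i) <= e * cnorm h.

Definition holo_map N (phi : cvec N -> cvec N) : Prop :=
  forall j : 'I_N, holo_on_ball (fun z => phi z j).

Definition ncons (t : R) (v : nat -> R) : nat -> R :=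
  fun k => if k is k'.+1 then v k' else t.

Fixpoint iint (n : nat) (F : (nat -> R) -> \bar R) : \bar R :=
  match n with
  | 0 => F (fun _ => 0)
  | n'.+1 => (\int[@lebesgue_measure R]_t iint n' (fun v => F (ncons t v)))%E
  end.

Definition emb N (x : nat -> R) : cvec N :=
  fun i => complex.Complex (x (2 * i)%N) (x (2 * i).+1).

(** Integral over the sphere S_N against the normalized (rotation invariant)
    surface measure sigma_N, via the polar-coordinates (cone) formula
    int_S g dsigma = (1/V(B)) int_B g(x/|x|) dV(x). *)
Definition sphere_int N (g : cvec N -> \bar R) : \bar R :=
  (iint (2 * N) (fun x => if (cnorm (@emb N x) < 1)%R
                          then g (rscale (cnorm (@emb N x))^-1 (@emb N x))
                          else 0%E)
   * ((fine (iint (2 * N) (fun x => if (cnorm (@emb N x) < 1)%R then 1%E else 0%E)))^-1)%:E)%E.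

Definition orlicz (psi : R -> R) : Prop :=
  [/\ psi 0 = 0,
      (forall x, 0 <= x -> 0 <= psi x),
      (forall x y t, 0 <= x -> 0 <= y -> x != y -> 0 < t < 1 ->
          psi (t * x + (1 - t) * y) < t * psi x + (1 - t) * psi y),
      (forall e, 0 < e -> exists d, 0 < d /\
          forall x, 0 <= x < d -> `|psi x - psi 0| < e) &
      (forall M : R, exists x0 : R, forall x, x0 < x -> M < psi x / x)].

Definition delta2 (psi : R -> R) : Prop :=
  exists C : R, exists x0 : R, 0 < C /\ 0 < x0 /\
    forall x, x0 <= x -> psi x ^+ 2 <= psi (C * x).

(** Luxemburg norm on the sphere (+oo if the defining set is empty) *)
Definition lux N (psi : R -> R) (h : cvec N -> C) : \bar R :=
  ereal_inf [set c%:E | c in [set c : R | 0 < c /\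
     (sphere_int (fun z => (psi (cabs (h z) / c))%:E) <= 1)%E]].

Definition dil N (f : cvec N -> C) (r : R) : cvec N -> C :=
  fun z => f (rscale r z).

Definition hnorm N (psi : R -> R) (f : cvec N -> C) : \bar R :=
  ereal_sup [set lux psi (dil f r) | r in [set r : R | 0 < r < 1]].

Definition hardy N (psi : R -> R) (f : cvec N -> C) : Prop :=
  holo_on_ball f /\ (hnorm psi f < +oo)%E.

Definition comp_op_compact N (psi : R -> R) (phi : cvec N -> cvec N) : Prop :=
  (forall f, hardy psi f -> hardy psi (f \o phi)) /\
  forall fs : nat -> (cvec N -> C),
    (forall n, hardy psi (fs n)) ->
    (exists M : R, forall n, (hnorm psi (fs n) <= M%:E)%E) ->
    exists (sub : nat -> nat) (g : cvec N -> C),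
      {homo sub : m n / (m < n)%N >-> (m < n)%N} /\ hardy psi g /\
      (fun k => hnorm psi (fun z => fs (sub k) (phi z) - g z)) @ \oo --> 0%E.

End Defs.

(* Main.v *)
Require Import Defs.
From HB Require Import structures.
From mathcomp Require Import all_boot all_order all_algebra.
From mathcomp Require Import all_classical all_reals all_analysis.
From mathcomp Require Import measurable_realfun.
From mathcomp Require Import complex ring lra.
Set Implicit Arguments. Unset Strict Implicit. Unset Printing Implicit Defensive.
Import Order.TTheory GRing.Theory Num.Theory.
Import numFieldNormedType.Exports.
Local Open Scope classical_set_scope.
Local Open Scope ring_scope.

(** The symbol is [phi(z) = l(z_0) zeta] with
    [l(w) = 1 - k (1 - w)^(1/2^(m+1))]: for [m] large and [k] small it maps the
    disc into a Stolz angle at [1] as narrow as wanted, yet [phi] pulls the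
    [h]-neighbourhood of [zeta] back to a set of measure at least a fixed power
    of [h].  The functions [f_n(z) = A_n h_n / (1 + h_n - <z, zeta>)] with
    [h_n = psi(A_n)^-2] are bounded in [H^psi]: [<z, zeta>] has imaginary part
    of modulus at most [2 / psi(A_n)] only on a set of measure [O(1 / psi(A_n))],
    and [|f_n| <= A_n / psi(A_n)] off it.  On the other hand [|f_n o phi| >= A_n / 2]
    on a set of measure at least a power of [1 / psi(A_n)].  By iterating the
    Delta^2-condition, [psi(C^j A_n) >= psi(A_n)^(2^j)] beats that power for large
    [j], so the [f_n o phi] stay uniformly separated in norm when [A_n] grows
    geometrically. *)

(** * The iterated integral [iint] *)

(** The integral of a nonnegative function is a supremum over the simple functions below it, and
    those below [f] are also below [g]. The comparison thus applies to integrands built from an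
    arbitrary [g] on the sphere. *)
Lemma integral_mono (R : realType) (f g : R -> \bar R) :
  (forall x, 0 <= f x)%E -> (forall x, f x <= g x)%E ->
  (\int[@lebesgue_measure R]_x f x <= \int[@lebesgue_measure R]_x g x)%E.
Proof.
move=> f0 fg.
have g0 x : (0 <= g x)%E by exact: le_trans (f0 x) (fg x).
rewrite !ge0_integralE//.
apply: le_ereal_sup => _ [h /= hf <-]; exists h => //= x.
by apply: le_trans (hf x) _; rewrite !patch_setT.
Qed.

Lemma iint_ge0 (R : realType) n (F : (nat -> R) -> \bar R) :
  (forall v, 0 <= F v)%E -> (0 <= iint n F)%E.
Proof.
elim: n F => [|n IH] F F0 //=; apply: integral_ge0 => t _.
exact: IH.
Qed.

Lemma le_iint (R : realType) n (F G : (nat -> R) -> \bar R) :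
  (forall v, 0 <= F v)%E -> (forall v, F v <= G v)%E -> (iint n F <= iint n G)%E.
Proof.
elim: n F G => [|n IH] F G F0 FG //=.
apply: integral_mono => t; first exact: iint_ge0.
exact: IH.
Qed.

Lemma eq_iint (R : realType) n (F G : (nat -> R) -> \bar R) :
  F =1 G -> iint n F = iint n G.
Proof. by move=> /funext ->. Qed.

(* Universal measurability under substitution of measurable coordinates: it
   avoids putting a sigma-algebra on [nat -> R] and is stable under [ncons]. *)
Definition pmeas (R : realType) d (T : measurableType d)
    (F : T -> (nat -> R) -> \bar R) : Prop :=
  forall d' (T' : measurableType d') (p : T' -> T) (X : nat -> T' -> R),
    measurable_fun setT p -> (forall i, measurable_fun setT (X i)) ->
    measurable_fun setT (fun x => F (p x) (fun i => X i x)).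

Definition vmeas (R : realType) (F : (nat -> R) -> \bar R) : Prop :=
  forall d' (T' : measurableType d') (X : nat -> T' -> R),
    (forall i, measurable_fun setT (X i)) ->
    measurable_fun setT (fun x => F (fun i => X i x)).

(** The outermost integration variable is adjoined to the parameter, so the induction hypothesis is
    used over [T * R]; Tonelli then integrates that variable out. This is why the parameter space
    varies in the induction. *)
Lemma pmeas_iint (R : realType) n : forall d (T : measurableType d)
    (F : T -> (nat -> R) -> \bar R),
  (forall t v, 0 <= F t v)%E -> pmeas F ->
  measurable_fun setT (fun t => iint n (F t)).
Proof.
elim: n => [|n IH] d T F F0 mF /=.
  by apply: (mF _ _ id (fun _ _ => 0)) => // i; exact: measurable_cst.
pose G (ts : T * R) := iint n (fun v => F ts.1 (Defs.ncons ts.2 v)).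
have mG : measurable_fun setT G.
  apply: IH => [[t s] v|d' T' p X mp mX] /=; first exact: F0.
  have := mF _ _ (fst \o p) (fun i => if i is j.+1 then X j else snd \o p).
  move=> /(_ (measurableT_comp measurable_fst mp)) H.
  rewrite [X in measurable_fun _ X](_ : _ = (fun x => F ((fst \o p) x) (fun i =>
     (if i is j.+1 then X j else snd \o p) x))); last first.
    by apply/funext => x /=; congr (F _ _); apply/funext => -[].
  apply: H => -[|i]; last exact: mX.
  exact: measurableT_comp measurable_snd mp.
have := @measurable_fun_fubini_tonelli_F _ _ _ _ _ (@lebesgue_measure R) G mG.
by apply => ts; apply: iint_ge0 => v; exact: F0.
Qed.

Lemma pmeas_ncons (R : realType) (F : (nat -> R) -> \bar R) :
  vmeas F -> pmeas (fun (t : R) v => F (Defs.ncons t v)).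
Proof.
move=> mF d' T' p X mp mX.
rewrite [X in measurable_fun _ X](_ : _ = (fun x => F (fun i =>
     (if i is j.+1 then X j else p) x))); last first.
  by apply/funext => x /=; congr F; apply/funext => -[].
by apply: mF => -[|i].
Qed.

Lemma vmeas_ncons (R : realType) (F : (nat -> R) -> \bar R) t :
  vmeas F -> vmeas (fun v => F (Defs.ncons t v)).
Proof.
move=> mF d' T' X mX.
exact: (pmeas_ncons mF (measurable_cst t) mX).
Qed.

Lemma measurable_iint_ncons (R : realType) n (F : (nat -> R) -> \bar R) :
  (forall v, 0 <= F v)%E -> vmeas F ->
  measurable_fun setT (fun t => iint n (fun v => F (Defs.ncons t v))).
Proof. by move=> F0 /pmeas_ncons mF; exact: pmeas_iint. Qed.

Lemma iintD (R : realType) n (F G : (nat -> R) -> \bar R) :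
  (forall v, 0 <= F v)%E -> (forall v, 0 <= G v)%E -> vmeas F -> vmeas G ->
  iint n (fun v => F v + G v)%E = (iint n F + iint n G)%E.
Proof.
elim: n F G => [|n IH] F G F0 G0 mF mG //=.
rewrite -ge0_integralD//; first last.
- exact: measurable_iint_ncons.
- by move=> x _; exact: iint_ge0.
- exact: measurable_iint_ncons.
- by move=> x _; exact: iint_ge0.
by apply: eq_integral => t _; rewrite IH//; exact: vmeas_ncons.
Qed.

Lemma iintZ (R : realType) n (F : (nat -> R) -> \bar R) (c : R) :
  (forall v, 0 <= F v)%E -> vmeas F -> 0 <= c ->
  iint n (fun v => c%:E * F v)%E = (c%:E * iint n F)%E.
Proof.
move=> + + c0.
elim: n F => [|n IH] F F0 mF //=.
rewrite -ge0_integralZl_EFin//; first last.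
- exact: measurable_iint_ncons.
- by move=> x _; exact: iint_ge0.
by apply: eq_integral => t _; rewrite IH//; exact: vmeas_ncons.
Qed.

(** * Volumes of boxes and of slabs in a cube *)

Fixpoint box (R : realType) n (lo hi v : nat -> R) : bool :=
  if n is n'.+1 then
    (lo 0%N <= v 0%N <= hi 0%N) &&
      box n' (fun i => lo i.+1) (fun i => hi i.+1) (fun i => v i.+1)
  else true.

Lemma boxP (R : realType) n (lo hi v : nat -> R) :
  reflect (forall i, (i < n)%N -> lo i <= v i <= hi i) (box n lo hi v).
Proof.
elim: n lo hi v => [|n IH] lo hi v /=; first by left.
apply: (iffP andP) => [[h0 /IH h] [|i] //|h]; first exact: h.
by split; [exact: h|apply/IH => i ni; exact: (h i.+1)].
Qed.

Lemma vmeas_bool (R : realType) (P : (nat -> R) -> bool) :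
  (forall d' (T' : measurableType d') (X : nat -> T' -> R),
    (forall i, measurable_fun setT (X i)) ->
    measurable_fun setT (fun x => P (fun i => X i x))) ->
  vmeas (fun v => (P v)%:R%:E : \bar R).
Proof.
move=> mP d' T' X mX; apply/measurable_EFinP.
rewrite [X in measurable_fun _ X](_ : _ = (fun x => if P (fun i => X i x) then 1 else 0)).
  by apply: measurable_fun_ifT => //; exact: mP.
by apply/funext => x; case: (P _).
Qed.

Lemma measurable_box (R : realType) n (lo hi : nat -> R) d' (T' : measurableType d')
    (X : nat -> T' -> R) :
  (forall i, measurable_fun setT (X i)) ->
  measurable_fun setT (fun x => box n lo hi (fun i => X i x)).
Proof.
elim: n lo hi X => [|n IH] lo hi X mX /=; first exact: measurable_cst.
apply: measurable_and; first by apply: measurable_and; apply: measurable_fun_ler.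
by apply: (IH _ _ (fun i => X i.+1)) => i; exact: mX.
Qed.

(** The factor is [0] or [1], so a case split proves this for every [F], whereas [iintZ] asks for a
    nonnegative measurable one. *)
Lemma iint_bool_mulr (R : realType) n (b : bool) (F : (nat -> R) -> \bar R) :
  iint n (fun v => b%:R%:E * F v)%E = (b%:R%:E * iint n F)%E.
Proof.
case: b => /=; first by rewrite mul1e; apply: eq_iint => v; rewrite mul1e.
rewrite mul0e (_ : (fun v => 0%R%:E * F v)%E = fun=> 0%E); last first.
  by apply/funext => v; rewrite mul0e.
by elim: n => //= n ->; rewrite integral0.
Qed.

Lemma itvcc_indic (R : realType) (a b t : R) :
  (a <= t <= b)%R%:R = \1_(`[a, b] : set R) t :> R.
Proof.
rewrite indicE; congr (nat_of_bool _)%:R.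
by apply/idP/idP; rewrite inE /= in_itv.
Qed.

Lemma integral_itvcc (R : realType) (a b : R) : a <= b ->
  (\int[@lebesgue_measure R]_t ((a <= t <= b)%R%:R%:E) = (b - a)%:E)%E.
Proof.
move=> ab.
transitivity (\int[@lebesgue_measure R]_t (\1_(`[a, b] : set R) t)%:E)%E.
  by apply: eq_integral => t _; rewrite itvcc_indic.
rewrite integral_indic//= setIT lebesgue_measure_itv /= lte_fin.
by case: ltP => // ba; rewrite (@le_anti _ _ a b) ?ab// subrr.
Qed.

Lemma integral_mul_itvcc (R : realType) (k a b : R) : 0 <= k -> a <= b ->
  (\int[@lebesgue_measure R]_t (k%:E * (a <= t <= b)%R%:R%:E) = (k * (b - a))%:E)%E.
Proof.
move=> k0 ab; rewrite ge0_integralZl_EFin//=; first by rewrite integral_itvcc// EFinM.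
apply/measurable_EFinP.
rewrite [X in measurable_fun _ X](_ : _ = \1_(`[a, b] : set R)).
  exact: measurable_indic.
by apply/funext => t; exact: itvcc_indic.
Qed.

Lemma iint_box (R : realType) n (lo hi : nat -> R) :
  (forall i, (i < n)%N -> lo i <= hi i) ->
  iint n (fun v => (box n lo hi v)%:R%:E) = (\prod_(i < n) (hi i - lo i))%:E.
Proof.
elim: n lo hi => [|n IH] lo hi h /=; first by rewrite big_ord0.
rewrite big_ord_recl /=.
under eq_integral => t _.
  rewrite (@eq_iint _ _ _ (fun v => (lo 0%N <= t <= hi 0%N)%R%:R%:E *
     (box n (fun i => lo i.+1) (fun i => hi i.+1) v)%:R%:E)%E); last first.
    by move=> v; rewrite -EFinM -natrM mulnb.
  rewrite iint_bool_mulr IH; last by move=> i ni; exact: (h i.+1).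
  rewrite muleC; over.
rewrite integral_mul_itvcc ?h// 1?mulrC//.
by apply: prodr_ge0 => i _; rewrite subr_ge0; apply: (h i.+1); rewrite ltnS ltn_ord.
Qed.

(** Induction on the dimension. If a later coefficient is nonzero, the first variable is frozen and
    absorbed into [c], hence the uniformity in [c]. Otherwise only [l 0] is nonzero and the slab is
    the product of an interval of length [2 s / |l 0|] with a cube of volume [2^n]. *)
Lemma iint_cube_slab (R : realType) n (l : nat -> R) :
  (exists k, (k < n)%N /\ l k != 0) ->
  exists K : R, 0 <= K /\ forall c s : R, 0 <= s ->
    (iint n (fun v => (box n (fun _ => -1) (fun _ => 1) v &&
        (`|\sum_(i < n) l i * v i + c| <= s)%R)%:R%:E) <= (K * s)%:E)%E.
Proof.
elim: n l => [|n IH] l; first by case=> k [].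
case: (pselect (exists k, (k < n)%N /\ l k.+1 != 0)) => [tl _|tl].
  have [K [K0 HK]] := IH _ tl.
  exists (K * 2); split => [|c s s0 /=]; first by rewrite mulr_ge0.
  apply: (@le_trans _ _ (\int[@lebesgue_measure R]_t ((K * s)%:E * (-1 <= t <= 1)%R%:R%:E))%E).
    apply: integral_mono => t; first exact: iint_ge0.
    rewrite (@eq_iint _ _ _ (fun v => (-1 <= t <= 1)%R%:R%:E *
       (box n (fun _ => -1) (fun _ => 1) v &&
        (`|\sum_(i < n) l i.+1 * v i + (l 0%N * t + c)| <= s)%R)%:R%:E)%E); last first.
      move=> v; rewrite -EFinM -natrM mulnb andbA big_ord_recl /=.
      by rewrite addrCA addrA.
    rewrite iint_bool_mulr muleC; apply: lee_wpmul2r; first by rewrite lee_fin.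
    exact: HK.
  rewrite integral_mul_itvcc ?mulr_ge0//.
  by rewrite opprK lee_fin mulrAC.
case=> -[|k] [kn lk]; last by exfalso; apply: tl; exists k.
have l0 : 0 < `|l 0%N| by rewrite normr_gt0.
exists (2 ^+ n * 2 / `|l 0%N|); split => [|c s s0 /=].
  by rewrite divr_ge0 ?mulr_ge0 ?exprn_ge0.
pose a := (- c / l 0%N) - s / `|l 0%N|.
pose b := (- c / l 0%N) + s / `|l 0%N|.
apply: (@le_trans _ _ (\int[@lebesgue_measure R]_t ((2 ^+ n)%:E * (a <= t <= b)%R%:R%:E))%E).
  apply: integral_mono => t; first exact: iint_ge0.
  apply: (@le_trans _ _ (iint n (fun v => (a <= t <= b)%R%:R%:E *
       (box n (fun _ => -1) (fun _ => 1) v)%:R%:E)%E)).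
    apply: le_iint => v //.
    rewrite -EFinM -natrM mulnb lee_fin ler_nat big_ord_recl big1 /=; last first.
      move=> i _; apply/eqP; rewrite mulf_eq0; apply/orP; left.
      by apply/negPn/negP => li; apply: tl; exists i.
    rewrite addr0; case: (box n _ _ _); rewrite !(andbT, andbF)//=.
    case: (leP `| _ | s) => [h|]; rewrite ?andbF//.
    suff -> : a <= t <= b by case: (_ && _).
    rewrite -ler_distl.
    rewrite (_ : t - _ = (l 0%N * t + c) / l 0%N); last by field.
    by rewrite normrM normfV ler_pM2r ?invr_gt0.
  rewrite iint_bool_mulr iint_box; last by move=> i _; lra.
  rewrite muleC; apply: lee_wpmul2r; first by rewrite lee_fin.
  rewrite prodr_const card_ord opprK lee_fin.
  exact: lexx.
rewrite integral_mul_itvcc ?exprn_ge0//; last first.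
  by rewrite /a /b lerD2l (le_trans (y := 0)) ?oppr_le0 ?divr_ge0.
rewrite lee_fin le_eqVlt; apply/orP; left; apply/eqP; rewrite /a /b.
have: `|l 0%N| != 0 by rewrite normr_eq0.
move: (`|l 0%N|) (2 ^+ n) => L E L0.
by field; rewrite L0 lk.
Qed.

Lemma measurable_lin (R : realType) n (l : nat -> R) (c : R) d (T : measurableType d)
    (X : nat -> T -> R) :
  (forall i, measurable_fun setT (X i)) ->
  measurable_fun setT (fun x => \sum_(i < n) l i * X i x + c).
Proof.
move=> mX; apply: measurable_funD => //; apply: measurable_sum => i.
exact: measurable_funM.
Qed.

(** The integrand has the shape of the majorant of the test functions: [a s] off a slab of width of
    order [s], and about [a] on it. Both contributions are of order [a s]. *)
Lemma iint_cube_slab_const (R : realType) n (l : nat -> R) :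
  (exists k, (k < n)%N /\ l k != 0) ->
  exists K : R, 0 <= K /\ forall a s : R, 0 <= a -> 0 <= s ->
    (iint n (fun v => ((box n (fun _ => -1) (fun _ => 1) v)%:R *
        (a * (s + (`|\sum_(i < n) l i * v i| <= 2 * s)%R%:R)))%:E) <= (a * (K * s))%:E)%E.
Proof.
move=> /iint_cube_slab[K [K0 HK]].
exists (2 ^+ n + K * 2); split => [|a s a0 s0]; first by rewrite addr_ge0 ?mulr_ge0 ?exprn_ge0.
pose F (v : nat -> R) : \bar R := (box n (fun _ => -1) (fun _ => 1) v)%:R%:E.
pose G (v : nat -> R) : \bar R := (box n (fun _ => -1) (fun _ => 1) v &&
        (`|\sum_(i < n) l i * v i + 0| <= 2 * s)%R)%:R%:E.
have mF : vmeas F.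
  by apply: vmeas_bool => d T X mX; exact: measurable_box.
have mG : vmeas G.
  apply: vmeas_bool => d T X mX; apply: measurable_and; first exact: measurable_box.
  apply: measurable_fun_ler => //.
  by apply: measurableT_comp => //; exact: measurable_lin.
have F0 v : (0 <= F v)%E by rewrite lee_fin.
have G0 v : (0 <= G v)%E by rewrite lee_fin.
have mZ (H : (nat -> R) -> \bar R) k : vmeas H -> vmeas (fun v => k%:E * H v)%E.
  by move=> mH d T X mX; apply: measurable_funeM; exact: mH.
rewrite (@eq_iint _ _ _ (fun v => (a * s)%:E * F v + a%:E * G v)%E); last first.
  move=> v; rewrite /F /G -!EFinM -EFinD addr0; congr _%:E.
  by case: box => /=; rewrite ?mul1r ?mul0r ?mulr0 ?addr0// mulr1 mulrDr.
have as0 : 0 <= a * s by exact: mulr_ge0.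
have -> : iint n (fun v => (a * s)%:E * F v + a%:E * G v)%E =
    ((a * s)%:E * iint n F + a%:E * iint n G)%E.
  rewrite -(iintZ _ F0 mF as0) -(iintZ _ G0 mG a0).
  apply: (@iintD _ n (fun v => (a * s)%:E * F v)%E (fun v => a%:E * G v)%E).
  - by move=> v; rewrite mule_ge0.
  - by move=> v; rewrite mule_ge0.
  - exact: mZ.
  - exact: mZ.
rewrite mulrDl mulrDr EFinD; apply: leeD.
  rewrite iint_box; last by move=> i _; lra.
  by rewrite prodr_const card_ord opprK -EFinM -mulrA (mulrC s).
by rewrite [leRHS]EFinM lee_wpmul2l// -mulrA; apply: HK; rewrite mulr_ge0.
Qed.

(** * Measurability on spheres *)

Lemma floorP_itv (R : realType) (y : R) (m : int) :
  (Num.floor y == m) = (m%:~R <= y) && (y < (m + 1)%:~R).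
Proof.
apply/eqP/andP => [<-|[h1 h2]].
  by rewrite floor_le_tmp floorD1_gt.
by apply: floor_def; rewrite h1 h2.
Qed.

(* [G] is approximated along the grids of mesh [1 / (k + 1)], so it only needs to be
   continuous at the points [X x] and may be arbitrary elsewhere. *)
Lemma measurable_continuous_comp (R : realType) n (G : (nat -> R) -> R)
    d (T : measurableType d) (X : nat -> T -> R) :
  (forall i, measurable_fun setT (X i)) ->
  (forall x (e : R), 0 < e -> exists2 d : R, 0 < d &
     forall w : nat -> R, (forall i, (i < n)%N -> `|w i - X i x| < d) ->
       `|G w - G (fun i => X i x)| < e) ->
  measurable_fun setT (fun x => G (fun i => X i x)).
Proof.
move=> mX cG.
pose z (k : nat) x : {ffun 'I_n -> int} := [ffun i => Num.floor (k.+1%:R * X (nat_of_ord i) x)].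
(* The grid index [z k x] takes countably many values, so [H k (z k x)] is measurable whatever [G]
   is. Coordinates from [n] on default to [0]; the hypothesis on [G] compares the first [n] only. *)
pose H (k : nat) (m : {ffun 'I_n -> int}) : R :=
  G (fun i => if insub i is Some j then (m j)%:~R / k.+1%:R else 0).
apply: (@measurable_fun_cvg _ _ _ _ (fun k x => H k (z k x))).
  move=> k _ B mB; rewrite setTI.
  rewrite (_ : _ @^-1` B = \bigcup_m (if asbool (B (H k m)) then [set x | z k x = m] else set0)); last first.
    apply/seteqP; split => x /=.
      by move=> Bx; exists (z k x) => //=; rewrite asboolT.
    by move=> [m _]; case: ifPn => [/asboolP Bm /= ->|_].
  apply: countable_bigcupT_measurable; first exact: countableP.
  move=> m; case: ifPn => // _.
  rewrite (_ : [set x | _] = \big[setI/setT]_(i < n) [set x |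
     ((m i)%:~R <= k.+1%:R * X (nat_of_ord i) x) && (k.+1%:R * X (nat_of_ord i) x < (m i + 1)%:~R)]); last first.
    rewrite -bigcap_seq; apply/seteqP; split => x /=.
      by move=> <- i _ /=; rewrite -floorP_itv ffunE.
    move=> h; apply/ffunP => i; apply/eqP; rewrite ffunE floorP_itv.
    by apply: h; rewrite /= mem_index_enum.
  apply: bigsetI_measurable => i _.
  rewrite -[X in measurable X]setTI.
  have mkX : measurable_fun setT (fun x => k.+1%:R * X (nat_of_ord i) x).
    exact: measurable_funM.
  have : measurable_fun setT (fun x => ((m i)%:~R <= k.+1%:R * X (nat_of_ord i) x) &&
       (k.+1%:R * X (nat_of_ord i) x < (m i + 1)%:~R)).
    by apply: measurable_and; [exact: measurable_fun_ler|exact: measurable_fun_ltr].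
  by move=> /(_ measurableT [set true]); apply.
move=> x _; apply/cvgrPdist_lt => e e0.
have [d0 d00 hd] := cG x e e0.
near=> k.
rewrite distrC; apply: hd => i ni; rewrite insubT.
have k0 : 0 < k.+1%:R :> R by [].
rewrite /= ffunE /=.
have /andP[h1 h2] : (((Num.floor (k.+1%:R * X i x))%:~R <= k.+1%:R * X i x) &&
   (k.+1%:R * X i x < (Num.floor (k.+1%:R * X i x) + 1)%:~R)).
  by rewrite -floorP_itv.
have kd : k.+1%:R^-1 < d0.
  by near: k; exact: near_infty_natSinv_lt (PosNum d00).
apply: le_lt_trans kd.
have -> : (Num.floor (k.+1%:R * X i x))%:~R / k.+1%:R - X i x =
   ((Num.floor (k.+1%:R * X i x))%:~R - k.+1%:R * X i x) / k.+1%:R.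
  by field; rewrite gt_eqF.
rewrite normrM (gtr0_norm (_ : 0 < k.+1%:R^-1)) ?invr_gt0//.
rewrite -[leRHS]mul1r ler_pM2r ?invr_gt0// ler_norml.
move: h2; rewrite intrD; move: h1.
set a := _%:~R; set b := _ * _ => h1 h2.
by apply/andP; split; lra.
Unshelve. all: by end_near. Qed.

Lemma cnorm_emb (R : realType) N (v : nat -> R) :
  cnorm (@emb R N v) = Num.sqrt (\sum_(i < 2 * N) v i ^+ 2).
Proof.
rewrite /cnorm; congr Num.sqrt; elim: N => [|N IH]; first by rewrite muln0 !big_ord0.
by rewrite big_ord_recr IH mulnS addnC addn2 !big_ord_recr /= -addrA.
Qed.

Lemma emb_surj (R : realType) N (z : cvec R N) :
  exists v : nat -> R, z = @emb R N v.
Proof.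
exists (fun k => if insub k./2 is Some j then
    (if odd k then complex.Im (z j) else complex.Re (z j)) else 0).
apply/funext => i; rewrite /emb mul2n /= uphalf_double doubleK odd_double /=.
by rewrite valK; case: (z i).
Qed.

Lemma cnorm_emb_le (R : realType) N (v : nat -> R) :
  cnorm (@emb R N v) <= \sum_(i < 2 * N) `|v i|.
Proof.
rewrite cnorm_emb.
have s0 : 0 <= \sum_(i < 2 * N) `|v i| by exact: sumr_ge0.
rewrite -[leRHS]ger0_norm// -sqrtr_sqr ler_sqrt ?sqr_ge0//.
elim: (2 * N)%N {s0} => [|n IH]; first by rewrite !big_ord0 expr0n.
rewrite !big_ord_recr /= sqrrD -addrA (le_trans (lerD IH (lexx _)))// lerD2l.
rewrite real_normK ?num_real// lerDr mulrn_wge0// mulr_ge0//.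
exact: sumr_ge0.
Qed.

Lemma ler_cnorm_emb (R : realType) N (v : nat -> R) i : (i < 2 * N)%N ->
  `|v i| <= cnorm (@emb R N v).
Proof.
move=> iN; rewrite cnorm_emb -sqrtr_sqr ler_sqrt; last first.
  by apply: sumr_ge0 => j _; exact: sqr_ge0.
rewrite (bigD1 (Ordinal iN))//= lerDl.
by apply: sumr_ge0 => j _; exact: sqr_ge0.
Qed.

Lemma rscale_emb (R : realType) N (r : R) (v : nat -> R) :
  rscale r (@emb R N v) = emb (fun i => r * v i).
Proof.
apply/funext => i; rewrite /rscale /emb; apply/eqP.
by rewrite eq_complex /= !mul0r subr0 addr0 !eqxx.
Qed.

Lemma cadd_emb (R : realType) N (v w : nat -> R) :
  Defs.cadd (@emb R N v) (emb w) = emb (fun i => v i + w i).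
Proof. by []. Qed.

Lemma cnorm_ge0 (R : realType) N (z : cvec R N) : 0 <= cnorm z.
Proof. exact: sqrtr_ge0. Qed.

Lemma cnorm_rscale (R : realType) N (r : R) (z : cvec R N) : 0 <= r ->
  cnorm (rscale r z) = r * cnorm z.
Proof.
move=> r0; have [v ->] := emb_surj z; rewrite rscale_emb !cnorm_emb.
rewrite -{2}(ger0_norm r0) -sqrtr_sqr -sqrtrM ?sqr_ge0//; congr Num.sqrt.
by rewrite mulr_sumr; apply: eq_bigr => i _; rewrite exprMn.
Qed.

(** Nothing is asked at points outside the open ball, where [holo_on_ball] gives no control. *)
Definition ball_continuous (R : realType) N (G : cvec R N -> R) : Prop :=
  forall z, cnorm z < 1 -> forall e : R, 0 < e -> exists2 d : R, 0 < d &
    forall h, cnorm h < d -> `|G (Defs.cadd z h) - G z| < e.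

(** The dilation by [r < 1] moves the normalised vector into the open ball, where [G] is continuous.
    Normalisation itself is discontinuous at the origin but measurable, which is why
    [measurable_continuous_comp] is applied to the dilated coordinates. *)
Lemma measurable_sphere_dil (R : realType) N (G : cvec R N -> R) (r : R)
    d (T : measurableType d) (X : nat -> T -> R) :
  (forall i, measurable_fun setT (X i)) -> ball_continuous G -> 0 < r < 1 ->
  measurable_fun setT (fun x => G (rscale r (rscale (cnorm (@emb R N (fun i => X i x)))^-1
    (emb (fun i => X i x))))).
Proof.
move=> mX cG /andP[r0 r1].
pose c x := (cnorm (@emb R N (fun i => X i x)))^-1.
have mc : measurable_fun setT c.
  rewrite (_ : c = (fun x => Num.sqrt
      (\sum_(i < 2 * N) X i x ^+ 2) `^ (-1))); last first.
    by apply/funext => x; rewrite /c cnorm_emb powRN powRr1 ?sqrtr_ge0.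
  apply: (measurableT_comp (measurable_powR (-1))).
  have msqrt : measurable_fun setT (@Num.sqrt R).
    by apply: nondecreasing_measurable => // x y; exact: ler_wsqrtr.
  apply: (measurableT_comp msqrt).
  by apply: measurable_sum => i; exact: measurable_funX.
pose Y i x := r * (c x * X i x).
have mY i : measurable_fun setT (Y i).
  by apply: measurable_funM => //; exact: measurable_funM.
rewrite [X in measurable_fun _ X](_ : _ = (fun x => G (emb (fun i => Y i x)))); last first.
  by apply/funext => x; rewrite !rscale_emb.
apply: (@measurable_continuous_comp _ (2 * N) (fun v => G (emb v))) => // x e e0.
have Yx1 : cnorm (@emb R N (fun i => Y i x)) < 1.
  rewrite -rscale_emb cnorm_rscale ?(ltW r0)// -rscale_emb cnorm_rscale; last first.
    by rewrite invr_ge0 cnorm_ge0.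
  rewrite -/(c x); apply: le_lt_trans r1; rewrite -[leRHS]mulr1 ler_pM2l//.
  rewrite /c; have [->|nz] := eqVneq (cnorm (@emb R N (fun i => X i x))) 0.
    by rewrite mulr0.
  by rewrite mulVf.
have [d0 d00 hd] := cG _ Yx1 e e0.
(* With the divisor [2N + 1], the sum of [2N] coordinate errors stays strictly below [d0], also for
   [N = 0]. *)
exists (d0 / (2 * N).+1%:R) => [|w hw]; first by rewrite divr_gt0.
rewrite (_ : emb w = Defs.cadd (emb (fun i => Y i x)) (emb (fun i => w i - Y i x))); last first.
  by rewrite cadd_emb; congr emb; apply/funext => i; rewrite addrC subrK.
apply: hd; apply: le_lt_trans (cnorm_emb_le _ _) _.
apply: (@le_lt_trans _ _ (\sum_(i < 2 * N) (d0 / (2 * N).+1%:R))).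
  by apply: ler_sum => i _; apply: ltW; exact: hw.
rewrite sumr_const card_ord -[X in X < _]mulr_natl mulrCA -[ltRHS]mulr1 ltr_pM2l//.
by rewrite ltr_pdivrMr// mul1r ltr_nat.
Qed.

(** * Estimates for [sphere_int] and the Hardy-Orlicz norm *)

Definition ball_vol (R : realType) N : R :=
  fine (iint (2 * N) (fun x => if (cnorm (@emb R N x) < 1)%R then 1%E else 0%E)).

(** The integrand in the numerator of [sphere_int]: [g] extended to the unit ball so as to be
    constant along rays. *)
Definition cone (R : realType) N (g : cvec R N -> \bar R) (v : nat -> R) : \bar R :=
  if (cnorm (@emb R N v) < 1)%R
  then g (rscale (cnorm (@emb R N v))^-1 (@emb R N v)) else 0%E.

(** The ball lies in the cube of half-side [1] and contains the cube of half-side [1 / (2N + 1)]. *)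
Lemma ball_volP (R : realType) N :
  0 < ball_vol R N /\
  iint (2 * N) (fun x => if (cnorm (@emb R N x) < 1)%R then 1%E else 0%E) =
    (ball_vol R N)%:E.
Proof.
rewrite /ball_vol; set F := (X in iint _ X); set V := iint _ _.
have F0 v : (0 <= F v)%E by rewrite /F; case: ifP => _; rewrite lee_fin.
have V0 : (0 <= V)%E by exact: iint_ge0.
have Vle : (V <= (\prod_(i < 2 * N) (1 - -1))%:E)%E.
  rewrite -(@iint_box R (2 * N) (fun=> -1) (fun=> 1)); last by move=> i _; lra.
  apply: le_iint => // v; rewrite /F; case: ifPn => [v1|_]; last by rewrite lee_fin.
  suff -> : box (2 * N) (fun=> -1) (fun=> 1) v by [].
  apply/boxP => i iN; rewrite -ler_norml.
  exact: le_trans (ler_cnorm_emb _ iN) (ltW v1).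
have Vf : V \is a fin_num.
  by rewrite ge0_fin_numE//; apply: le_lt_trans Vle _; rewrite ltry.
split; last by rewrite fineK.
rewrite -lte_fin fineK//.
pose e : R := (2 * N).+1%:R^-1.
have e0 : 0 < e by rewrite invr_gt0.
apply: (@lt_le_trans _ _ (\prod_(i < 2 * N) (e - -e))%:E).
  by rewrite lte_fin; apply: prodr_gt0 => i _; lra.
rewrite -(@iint_box R (2 * N) (fun=> -e) (fun=> e)); last by move=> i _; lra.
apply: le_iint => v; first by rewrite lee_fin.
case: (boxP (2 * N) (fun=> -e) (fun=> e) v) => hv; last exact: F0.
rewrite /F ifT//; apply: le_lt_trans (cnorm_emb_le _ _) _.
apply: (@le_lt_trans _ _ (\sum_(i < 2 * N) e)).
  by apply: ler_sum => i _; rewrite ler_norml; exact: hv.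
rewrite sumr_const card_ord -[X in X < _]mulr_natl /e.
by rewrite ltr_pdivrMr// mul1r ltr_nat.
Qed.

Lemma sphere_intE (R : realType) N (g : cvec R N -> \bar R) (x : R) :
  (sphere_int g <= x%:E)%E = (iint (2 * N) (cone g) <= (x * ball_vol R N)%:E)%E.
Proof. by rewrite /sphere_int lee_pdivrMr ?EFinM//; case: (ball_volP R N). Qed.

(** [sphere_int] evaluates its integrand only at normalised vectors, of norm [1] or, at the origin,
    [0]; comparing on the closed ball is enough. *)
Lemma sphere_int_mono (R : realType) N (g1 g2 : cvec R N -> \bar R) (x : R) :
  (forall w, 0 <= g1 w)%E -> (forall w, cnorm w <= 1 -> (g1 w <= g2 w)%E) ->
  (sphere_int g2 <= x%:E)%E -> (sphere_int g1 <= x%:E)%E.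
Proof.
move=> g0 g12; rewrite !sphere_intE; apply: le_trans.
apply: le_iint => v; rewrite /cone; case: ifP => // v1.
apply: g12; rewrite cnorm_rscale ?invr_ge0 ?cnorm_ge0//.
have [->|nz] := eqVneq (cnorm (@emb R N v)) 0; first by rewrite mulr0.
by rewrite mulVf.
Qed.

Lemma hnorm_le (R : realType) N (psi : R -> R) (f : cvec R N -> complex.complex R) (M : R) :
  0 < M -> (forall r, 0 < r < 1 ->
     (sphere_int (fun z => (psi (cabs (dil f r z) / M))%:E) <= 1)%E) ->
  (hnorm psi f <= M%:E)%E.
Proof.
move=> M0 h; apply: ge_ereal_sup => _ [r r01 <-].
by apply: ereal_inf_lbound; exists M => //; split => //; exact: h.
Qed.

Lemma hnorm_lt (R : realType) N (psi : R -> R) (f : cvec R N -> complex.complex R) (e : \bar R) :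
  (hnorm psi f < e)%E -> forall r, 0 < r < 1 ->
  exists c : R, [/\ 0 < c, (c%:E < e)%E &
     (sphere_int (fun z => (psi (cabs (dil f r z) / c))%:E) <= 1)%E].
Proof.
move=> h r r01.
have /ereal_inf_lt[_ [c [c0 hc] <-] ce] : (lux psi (dil f r) < e)%E.
  by apply: le_lt_trans h; apply: ereal_sup_ubound; exists r.
by exists c.
Qed.

Lemma Im_cdot_emb (R : realType) N (v u : nat -> R) :
  complex.Im (cdot (@emb R N v) (emb u)) =
  \sum_(k < 2 * N) (if odd k then u k.-1 else - u k.+1) * v k.
Proof.
rewrite /cdot; elim: N => [|N IH]; first by rewrite muln0 !big_ord0.
rewrite big_ord_recr.
have ImD (a b : complex.complex R) : complex.Im (a + b) = complex.Im a + complex.Im b.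
  by case: a; case: b.
rewrite ImD IH mulnS addnC addn2 !big_ord_recr /= -addrA; congr (_ + _).
by rewrite mul2n odd_double /=; ring.
Qed.

(** In real coordinates [Im <w, zeta>] is a nonzero linear form. If [x] lies in the unit ball and
    [x / |x|] in the slab, then so does [x], by homogeneity; the integral over the cone is therefore
    at most that over the slab in the cube. *)
Lemma sphere_slab (R : realType) N (zeta : cvec R N) : cnorm zeta = 1 ->
  exists K : R, 0 <= K /\ forall a s : R, 0 <= a -> 0 <= s -> forall g : cvec R N -> R,
    (forall w, 0 <= g w) ->
    (forall w, cnorm w <= 1 -> g w <= a * (s + (`|complex.Im (cdot w zeta)| <= 2 * s)%R%:R)) ->
    (sphere_int (fun w => (g w)%:E) <= (a * (K * s))%:E)%E.
Proof.
have [u ->] := emb_surj zeta; move=> u1.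
pose l k := if odd k then u k.-1 else - u k.+1.
have [|K [K0 HK]] := @iint_cube_slab_const R (2 * N) l.
  have [k kN uk] : exists2 k, (k < 2 * N)%N & u k != 0.
    apply: contrapT => h.
    have : cnorm (@emb R N u) <= 0.
      apply: le_trans (cnorm_emb_le _ _) _; rewrite big1// => i _.
      by apply/eqP; rewrite normr_eq0; apply/negPn/negP => ui; apply: h; exists i.
    by rewrite u1 ler10.
  (* Up to sign, a coordinate of [u] is the coefficient in [l] of its partner in the pair of real
     and imaginary parts. *)
  exists (if odd k then k.-1 else k.+1); rewrite /l; case: ifPn => ok.
    case: k ok kN uk => //= k ok kN uk.
    by rewrite (negbTE ok) oppr_eq0; split => //; exact: ltnW.
  split; last by rewrite /= ok.
  rewrite ltn_neqAle kN andbT; apply/eqP => k2.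
  by move: ok; rewrite -[odd k]negbK -oddS k2 mul2n odd_double.
have [V0 _] := ball_volP R N.
exists (K / ball_vol R N); split => [|a s a0 s0 g g0 hg]; first by rewrite divr_ge0// ltW.
rewrite sphere_intE -(mulrA a) (mulrAC K) divfK ?gt_eqF//.
apply: le_trans (HK a s a0 s0); apply: le_iint => v.
  by rewrite /cone; case: ifP; rewrite lee_fin.
rewrite /cone; case: ifPn => v1; rewrite lee_fin; last first.
  by rewrite !mulr_ge0// addr_ge0.
have -> : box (2 * N) (fun=> -1) (fun=> 1) v.
  apply/boxP => i iN; rewrite -ler_norml.
  exact: le_trans (ler_cnorm_emb _ iN) (ltW v1).
rewrite mul1r; set c := cnorm _ in v1 *.
have c0 : 0 <= c by exact: cnorm_ge0.
apply: le_trans (hg _ _) _.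
  rewrite cnorm_rscale ?invr_ge0// -/c.
  have [->|nz] := eqVneq c 0; first by rewrite mulr0.
  by rewrite mulVf.
rewrite ler_wpM2l// lerD2l ler_nat rscale_emb Im_cdot_emb.
suff -> : \sum_(i < 2 * N) l i * v i = c * \sum_(k < 2 * N) l k * (c^-1 * v k).
  set t := \sum_(_ < _) _; case: (leP `|t| _) => // ht.
  rewrite (_ : `|c * t| <= 2 * s)//.
  rewrite normrM (ger0_norm c0) (le_trans _ ht)// ler_piMl//.
  exact: ltW.
rewrite mulr_sumr; apply: eq_bigr => k _; rewrite mulrCA; congr (_ * _).
have [cz|nz] := eqVneq c 0; last by rewrite mulrA mulfV// mul1r.
rewrite cz mul0r; apply/eqP; rewrite -normr_le0 -cz.
by apply: ler_cnorm_emb.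
Qed.

Lemma cabs_ge0 (R : realType) (z : complex.complex R) : 0 <= cabs z.
Proof. exact: sqrtr_ge0. Qed.

Lemma cabs_le (R : realType) (z : complex.complex R) :
  cabs z <= `|complex.Re z| + `|complex.Im z|.
Proof.
rewrite /cabs -[leRHS]ger0_norm ?addr_ge0// -sqrtr_sqr ler_sqrt ?sqr_ge0//.
rewrite sqrrD !real_normK ?num_real// addrAC lerDl.
by rewrite mulrn_wge0// mulr_ge0.
Qed.

(** The coordinates other than the first add up to at most [eta / 8], so [c] exceeds [v 0] by at
    most [eta / 8], and [|v 1|] is at most [eta / 8]. Dividing these two errors by [c >= 1/4] gives
    [eta]. *)
Lemma polar_box (R : realType) N (N0 : (0 < N)%N) (eta : R) (v : nat -> R) :
  0 < eta <= 1 -> 1 / 4 <= v 0%N <= 1 / 2 ->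
  (forall i, (0 < i < 2 * N)%N -> `|v i| <= eta / (8 * (2 * N)%:R)) ->
  cnorm (@emb R N v) < 1 /\
  cabs (1 - rscale (cnorm (@emb R N v))^-1 (emb v) (Ordinal N0)) <= eta.
Proof.
move=> /andP[e0 e1] /andP[v0 v0'] hv.
set c := cnorm _.
have D0 : 0 < (2 * N)%:R :> R by rewrite ltr0n muln_gt0.
pose S := \sum_(1 <= i < 2 * N) `|v i|.
have S_le : S <= eta / 8.
  apply: (@le_trans _ _ (\sum_(1 <= i < 2 * N) eta / (8 * (2 * N)%:R))).
    by rewrite /S !big_nat; apply: ler_sum => i hi; exact: hv.
  rewrite sumr_const_nat -[leLHS]mulr_natl.
  apply: (@le_trans _ _ ((2 * N)%:R * (eta / (8 * (2 * N)%:R)))).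
    rewrite ler_pM2r ?divr_gt0 ?mulr_gt0// ler_nat.
    by rewrite leq_subr.
  have mulK8 (x D : R) : D != 0 -> D * (x / (8 * D)) = x / 8 by move=> ?; field.
  by rewrite mulK8 ?gt_eqF.
have S1 : `|v 1%N| <= S.
  have N2 : (1 < 2 * N)%N by rewrite (leq_trans (_ : 1 < 2 * 1)%N)// leq_mul2l.
  rewrite /S big_ltn// lerDl; exact: sumr_ge0.
have cv0 : v 0%N <= c.
  apply: le_trans (ler_norm _) _; apply: ler_cnorm_emb.
  by rewrite muln_gt0.
have cS : c <= v 0%N + S.
  apply: le_trans (cnorm_emb_le _ _) _.
  rewrite -(big_mkord xpredT (fun i => `|v i|)) big_ltn ?muln_gt0//.
  by rewrite ger0_norm//; lra.
split; first by lra.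
have c0 : 0 < c by lra.
apply: le_trans (cabs_le _) _.
rewrite rscale_emb /emb /= muln0.
rewrite sub0r normrN normrM.
have -> : 1 - c^-1 * v 0%N = c^-1 * (c - v 0%N) by field; rewrite gt_eqF.
rewrite normrM ger0_norm ?invr_ge0 ?(ltW c0)// (ger0_norm (_ : 0 <= c - _)) ?subr_ge0//.
rewrite -mulrDr mulrC ler_pdivrMr//.
have : eta / 4 <= eta * c by rewrite ler_pM2l//; lra.
by lra.
Qed.

(** A Chebyshev inequality for two functions at once. By [polar_box] the cap [|1 - w_0| <= eta] has
    measure at least a multiple of [eta^(2N-1)]; two superlevel sets cover it, and on them [q1] or
    [q2] is at least [P]. The continuous [G1] and [G2] make these sets measurable, so the volumes
    may be added. *)
Lemma sphere_int_cover (R : realType) N (N0 : (0 < N)%N) : exists c : R, 0 < c /\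
  forall (eta r : R), 0 < eta <= 1 -> 0 < r < 1 ->
  forall (G1 G2 q1 q2 : cvec R N -> R) (a P : R),
    ball_continuous G1 -> ball_continuous G2 -> 0 <= P ->
    (forall w, 0 <= q1 w) -> (forall w, 0 <= q2 w) ->
    (forall w, cabs (1 - w (Ordinal N0)) <= eta ->
       a <= G1 (rscale r w) \/ a <= G2 (rscale r w)) ->
    (forall w, a <= G1 (rscale r w) -> P <= q1 w) ->
    (forall w, a <= G2 (rscale r w) -> P <= q2 w) ->
    (sphere_int (fun w => (q1 w)%:E) <= 1)%E ->
    (sphere_int (fun w => (q2 w)%:E) <= 1)%E ->
    P * (c * eta ^+ (2 * N).-1) <= 1.
Proof.
have [V0 _] := ball_volP R N.
have D0 : 0 < (2 * N)%:R :> R by rewrite ltr0n muln_gt0.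
set V := ball_vol R N in V0 *.
pose k := (2 / (8 * (2 * N)%:R) : R).
have k0 : 0 < k by rewrite divr_gt0// mulr_gt0.
exists (k ^+ (2 * N).-1 / (8 * V)); split; first by rewrite divr_gt0 ?exprn_gt0// mulr_gt0.
move=> eta r he hr G1 G2 q1 q2 a P cG1 cG2 P0 q10 q20 cov h1 h2.
rewrite !sphere_intE mul1r -/V => i1 i2.
have /andP[e0 e1] := he.
pose lo i : R := if i is 0%N then 1 / 4 else - (eta / (8 * (2 * N)%:R)).
pose hi i : R := if i is 0%N then 1 / 2 else eta / (8 * (2 * N)%:R).
pose dir (v : nat -> R) := rscale (cnorm (@emb R N v))^-1 (@emb R N v).
pose A (G : cvec R N -> R) (v : nat -> R) := box (2 * N) lo hi v && (a <= G (rscale r (dir v))).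
have mA G : ball_continuous G -> vmeas (fun v => (A G v)%:R%:E : \bar R).
  move=> cG; apply: vmeas_bool => d T X mX; apply: measurable_and; first exact: measurable_box.
  apply: measurable_fun_ler => //.
  exact: (measurable_sphere_dil mX cG hr).
have A0 G v : (0 <= (A G v)%:R%:E :> \bar R)%E by rewrite lee_fin.
have boxdir v : box (2 * N) lo hi v ->
    cnorm (@emb R N v) < 1 /\ cabs (1 - dir v (Ordinal N0)) <= eta.
  move=> /boxP hv; apply: polar_box => //; first by apply: (hv 0%N); rewrite muln_gt0.
  by move=> [//|i] /andP[_ iN]; rewrite ler_norml; exact: (hv i.+1).
have bound G q : ball_continuous G -> (forall w, 0 <= q w) ->
    (forall w, a <= G (rscale r w) -> P <= q w) ->
    (iint (2 * N) (cone (fun w => (q w)%:E)) <= V%:E)%E ->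
    (P%:E * iint (2 * N) (fun v => (A G v)%:R%:E) <= V%:E)%E.
  move=> cG q0 hG; apply: le_trans.
  rewrite -(iintZ _ (A0 G) (mA _ cG) P0).
  apply: le_iint => v; first by rewrite -EFinM lee_fin mulr_ge0.
  rewrite /A; case: (boolP (box _ _ _ _)) => [/boxdir[v1 _]|_] /=; last first.
    by rewrite mule0 /cone; case: ifP; rewrite lee_fin.
  rewrite /cone v1; case: (boolP (a <= _)) => [/hG|_]; rewrite -EFinM lee_fin.
    by rewrite mulr1.
  by rewrite mulr0.
have vol : (iint (2 * N) (fun v => (box (2 * N) lo hi v)%:R%:E) =
    (1 / 4 * (k * eta) ^+ (2 * N).-1)%:E)%E.
  rewrite iint_box; last first.
    move=> [|i] _ /=; first lra.
    have : 0 <= eta / (8 * (2 * N)%:R) by rewrite divr_ge0 ?mulr_ge0// ltW.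
    by lra.
  congr _%:E; rewrite -(prednK (_ : 0 < 2 * N)%N) ?muln_gt0// big_ord_recl /=.
  rewrite prodr_const card_ord; congr (_ * _ ^+ _); first by lra.
  by rewrite /k; ring.
have B1 := bound _ _ cG1 q10 h1 i1.
have B2 := bound _ _ cG2 q20 h2 i2.
have : ((P * (1 / 4 * (k * eta) ^+ (2 * N).-1))%:E <= V%:E + V%:E)%E.
  apply: le_trans (leeD B1 B2).
  have I0 G : (0 <= iint (2 * N) (fun v => (A G v)%:R%:E))%E.
    exact: iint_ge0.
  rewrite -ge0_muleDr// EFinM; apply: lee_wpmul2l; first by rewrite lee_fin.
  rewrite -(iintD _ (A0 G1) (A0 G2) (mA _ cG1) (mA _ cG2)).
  rewrite -vol; apply: le_iint => v; first by rewrite lee_fin.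
  rewrite -EFinD lee_fin -natrD ler_nat /A.
  case: (boolP (box _ _ _ _)) => //= /boxdir[_ /cov[->|->]] //.
  by rewrite addn1.
rewrite -EFinD lee_fin exprMn => H.
rewrite (_ : P * _ = (P * (1 / 4 * (k ^+ (2 * N).-1 * eta ^+ (2 * N).-1))) / (V + V)).
  by rewrite ler_pdivrMr ?addr_gt0// [leRHS]mul1r.
by field; rewrite ?gt_eqF// addr_gt0.
Qed.

(** * Complex modulus and differentiability *)

Section ComplexModulus.
Variable R : realType.
Implicit Types z w : R[i].

Lemma cabsE z : cabs z = Normc.normc z.
Proof. by case: z. Qed.

Lemma cabs0 : cabs (0 : R[i]) = 0.
Proof. by rewrite cabsE Normc.normc0. Qed.

Lemma cabsM z w : cabs (z * w) = cabs z * cabs w.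
Proof. by rewrite !cabsE Normc.normcM. Qed.

Lemma cabsV z : cabs z^-1 = (cabs z)^-1.
Proof. by rewrite !cabsE Normc.normcV. Qed.

Lemma cabsX z n : cabs (z ^+ n) = cabs z ^+ n.
Proof.
elim: n => [|n IH]; first by rewrite !expr0 cabsE Normc.normc1.
by rewrite !exprS cabsM IH.
Qed.

Lemma cabsD z w : cabs (z + w) <= cabs z + cabs w.
Proof. by rewrite !cabsE; exact: le_normcD. Qed.

Lemma cabsN z : cabs (- z) = cabs z.
Proof. by rewrite !cabsE; exact: normcN. Qed.

Lemma cabs_sub z w : `|cabs z - cabs w| <= cabs (z - w).
Proof.
rewrite ler_norml; apply/andP; split.
  have := cabsD (w - z) z; rewrite subrK -(cabsN (w - z)) opprB.
  by lra.
by have := cabsD (z - w) w; rewrite subrK; lra.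
Qed.

Lemma cabs_eq0 z : (cabs z == 0) = (z == 0).
Proof.
apply/eqP/eqP => [|->]; last exact: cabs0.
by rewrite cabsE => /Normc.eq0_normc.
Qed.

Lemma cabs_gt0 z : (0 < cabs z) = (z != 0).
Proof. by rewrite lt_neqAle cabs_ge0 andbT eq_sym cabs_eq0. Qed.

Lemma cabsR (x : R) : cabs (x%:C)%C = `|x|.
Proof. by rewrite /cabs /= expr0n addr0 sqrtr_sqr. Qed.

Lemma sqr_cabs z : cabs z ^+ 2 = complex.Re z ^+ 2 + complex.Im z ^+ 2.
Proof. by rewrite sqr_sqrtr// addr_ge0 ?sqr_ge0. Qed.

Lemma ler_Re_cabs z : `|complex.Re z| <= cabs z.
Proof. by rewrite -sqrtr_sqr ler_sqrt ?addr_ge0 ?sqr_ge0// lerDl sqr_ge0. Qed.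

Lemma ler_Im_cabs z : `|complex.Im z| <= cabs z.
Proof. by rewrite -sqrtr_sqr ler_sqrt ?addr_ge0 ?sqr_ge0// lerDr sqr_ge0. Qed.

Lemma ReD z w : complex.Re (z + w) = complex.Re z + complex.Re w.
Proof. by case: z; case: w. Qed.

Lemma ImD z w : complex.Im (z + w) = complex.Im z + complex.Im w.
Proof. by case: z; case: w. Qed.

Lemma ReN z : complex.Re (- z) = - complex.Re z.
Proof. by case: z. Qed.

Lemma ImN z : complex.Im (- z) = - complex.Im z.
Proof. by case: z. Qed.

Lemma ReZ (x : R) z : complex.Re ((x%:C)%C * z) = x * complex.Re z.
Proof. by case: z => a b /=; rewrite mul0r subr0. Qed.

Lemma ImZ (x : R) z : complex.Im ((x%:C)%C * z) = x * complex.Im z.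
Proof. by case: z => a b /=; rewrite mul0r addr0. Qed.

Lemma cabs_sum (I : Type) (s : seq I) (F : I -> R[i]) :
  cabs (\sum_(i <- s) F i) <= \sum_(i <- s) cabs (F i).
Proof.
elim: s => [|i s IH]; first by rewrite !big_nil cabs0.
by rewrite !big_cons (le_trans (cabsD _ _))// lerD2l.
Qed.

Lemma ler_cabs_cnorm N (z : cvec R N) i : cabs (z i) <= cnorm z.
Proof.
rewrite ler_sqrt; last by apply: sumr_ge0 => j _; rewrite addr_ge0 ?sqr_ge0.
rewrite (bigD1 i)//= lerDl.
by apply: sumr_ge0 => j _; rewrite addr_ge0 ?sqr_ge0.
Qed.

End ComplexModulus.

(** * Complex differentiability at a point, in several variables and in one *)

Section Holomorphy.
Variable R : realType.

Definition holo_at N (f : cvec R N -> R[i]) (z : cvec R N) : Prop :=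
  exists a : 'I_N -> R[i], forall e : R, 0 < e -> exists d : R, 0 < d /\
    forall h : cvec R N, cnorm h < d ->
      cabs (f (Defs.cadd z h) - f z - \sum_(i < N) a i * h i) <= e * cnorm h.

Definition cderivable (g : R[i] -> R[i]) (w : R[i]) : Prop :=
  exists b : R[i], forall e : R, 0 < e -> exists d : R, 0 < d /\
    forall h : R[i], cabs h < d -> cabs (g (w + h) - g w - b * h) <= e * cabs h.

Lemma eq_holo_at N (f g : cvec R N -> R[i]) z : f =1 g -> holo_at f z -> holo_at g z.
Proof. by move=> /funext ->. Qed.

Lemma cabs_lin_le N (a : 'I_N -> R[i]) (h : cvec R N) :
  cabs (\sum_(i < N) a i * h i) <= (\sum_(i < N) cabs (a i)) * cnorm h.
Proof.
apply: le_trans (cabs_sum _ _) _; rewrite mulr_suml; apply: ler_sum => i _.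
by rewrite cabsM ler_wpM2l ?cabs_ge0// ler_cabs_cnorm.
Qed.

Lemma holo_at_lipschitz N (f : cvec R N -> R[i]) z : holo_at f z ->
  exists L : R, 0 < L /\ exists d : R, 0 < d /\ forall h : cvec R N, cnorm h < d ->
    cabs (f (Defs.cadd z h) - f z) <= L * cnorm h.
Proof.
move=> [a /(_ 1 ltr01)[d [d0 hd]]].
exists (\sum_(i < N) cabs (a i) + 1); split.
  by rewrite ltr_wpDl//; apply: sumr_ge0 => i _; exact: cabs_ge0.
exists d; split => // h /hd; rewrite mul1r => hh.
rewrite -[X in cabs X](subrK (\sum_(i < N) a i * h i)).
apply: le_trans (cabsD _ _) _; rewrite mulrDl mul1r addrC lerD//.
exact: cabs_lin_le.
Qed.

Lemma holo_at_comp N (f : cvec R N -> R[i]) (g : R[i] -> R[i]) z :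
  holo_at f z -> cderivable g (f z) -> holo_at (g \o f) z.
Proof.
move=> hf; have [L [L0 [d1 [d10 hL]]]] := holo_at_lipschitz hf.
case: hf => a ha [b hb]; exists (fun i => b * a i) => e e0.
have B0 : 0 < cabs b + 1 by rewrite ltr_wpDl ?cabs_ge0.
have [|d2 [d20 h2]] := ha (e / 2 / (cabs b + 1)); first by rewrite !divr_gt0.
have [|d3 [d30 h3]] := hb (e / 2 / L); first by rewrite !divr_gt0.
exists (Num.min (Num.min d1 d2) (d3 / L)); split.
  by rewrite !lt_min d10 d20 divr_gt0.
move=> h; rewrite !lt_min => /andP[/andP[hd1 hd2]]; rewrite ltr_pdivlMr// => hd3.
have {}hL := hL _ hd1; have {}h2 := h2 _ hd2.
have := h3 (f (Defs.cadd z h) - f z); rewrite [f z + _]addrC subrK => {}h3.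
have {}h3 : cabs (g (f (Defs.cadd z h)) - g (f z) - b * (f (Defs.cadd z h) - f z))
    <= e / 2 * cnorm h.
  have /h3 : cabs (f (Defs.cadd z h) - f z) < d3.
    by apply: le_lt_trans hL _; rewrite mulrC.
  move=> /le_trans; apply; apply: (@le_trans _ _ (e / 2 / L * (L * cnorm h))).
    by rewrite ler_wpM2l// !divr_ge0// ltW.
  by rewrite mulrA divfK// gt_eqF.
rewrite /=; set u := g _ - g _ in h3 *; set v := f _ - f _ in h2 h3 *.
rewrite (_ : \sum_(i < N) _ = b * \sum_(i < N) a i * h i); last first.
  by rewrite mulr_sumr; apply: eq_bigr => i _; rewrite mulrA.
set S := \sum_(i < N) _ in h2 *.
have -> : u - b * S = (u - b * v) + b * (v - S) by ring.
apply: le_trans (cabsD _ _) _; rewrite [e](splitr) mulrDl lerD//.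
rewrite cabsM; apply: le_trans (_ : (cabs b + 1) * cabs (v - S) <= _).
  by rewrite ler_wpM2r ?cabs_ge0// lerDl.
by rewrite mulrC -ler_pdivlMr// mulrAC.
Qed.

Lemma holo_at_coord N (i : 'I_N) z : holo_at (fun z : cvec R N => z i) z.
Proof.
exists (fun j => (i == j)%:R) => e e0; exists 1; split => // h _.
rewrite (bigD1 i)//= eqxx mul1r big1; last first.
  by move=> j /negbTE ji; rewrite eq_sym ji mul0r.
rewrite addr0 /Defs.cadd addrAC addrK subrr cabs0 mulr_ge0 ?cnorm_ge0//.
exact: ltW.
Qed.

Lemma holo_at_cdot N (zeta : cvec R N) z : holo_at (fun z => cdot z zeta) z.
Proof.
exists (fun j => complex.conjc (zeta j)) => e e0; exists 1; split => // h _.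
rewrite (_ : cdot (Defs.cadd z h) zeta = cdot z zeta + \sum_(i < N) complex.conjc (zeta i) * h i).
  by rewrite [cdot z _ + _]addrC addrK subrr cabs0 mulr_ge0 ?cnorm_ge0// ltW.
rewrite /cdot -big_split; apply: eq_bigr => i _ /=.
by rewrite /Defs.cadd mulrDl [in X in _ + X = _]mulrC.
Qed.

Lemma holo_at_sub N (f g : cvec R N -> R[i]) z : holo_at f z -> holo_at g z ->
  holo_at (fun z => f z - g z) z.
Proof.
move=> [a ha] [b hb]; exists (fun i => a i - b i) => e e0.
have e2 : 0 < e / 2 by rewrite divr_gt0.
have [d1 [d10 h1]] := ha _ e2; have [d2 [d20 h2]] := hb _ e2.
exists (Num.min d1 d2); split; first by rewrite lt_min d10.
move=> h; rewrite lt_min => /andP[/h1 {}h1 /h2 {}h2].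
under eq_bigr do rewrite mulrBl.
rewrite big_split sumrN /=.
set S := \sum_(i < N) _ in h1 *; set S' := \sum_(i < N) _ in h2 *.
set x := f (Defs.cadd _ _) in h1 *; set y := g (Defs.cadd _ _) in h2 *.
have -> : x - y - (f z - g z) - (S - S') = (x - f z - S) - (y - g z - S') by ring.
apply: le_trans (cabsD _ _) _; rewrite cabsN [e](splitr) mulrDl.
exact: lerD.
Qed.

Lemma ball_continuous_cabs N (f : cvec R N -> R[i]) :
  (forall z, cnorm z < 1 -> holo_at f z) -> ball_continuous (fun z => cabs (f z)).
Proof.
move=> hf z /hf/holo_at_lipschitz[L [L0 [d [d0 hd]]]] e e0.
exists (Num.min d (e / L)); first by rewrite lt_min d0 divr_gt0.
move=> h; rewrite lt_min => /andP[/hd {}hd]; rewrite ltr_pdivlMr// => he.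
apply: le_lt_trans (cabs_sub _ _) _; apply: le_lt_trans hd _.
by rewrite mulrC.
Qed.

Lemma cderivable_affine (a b w : R[i]) : cderivable (fun w => a + b * w) w.
Proof.
exists b => e e0; exists 1; split => // h _.
have -> : a + b * (w + h) - (a + b * w) - b * h = 0 by ring.
by rewrite cabs0 mulr_ge0 ?cabs_ge0// ltW.
Qed.

Lemma cderivable_inv (w : R[i]) : w != 0 -> cderivable GRing.inv w.
Proof.
move=> w0; have c0 : 0 < cabs w by rewrite cabs_gt0.
exists (- w^-1 ^+ 2) => e e0.
exists (Num.min (cabs w / 2) (e * cabs w ^+ 3 / 2)); split.
  by rewrite lt_min !divr_gt0// mulr_gt0// exprn_gt0.
move=> h; rewrite lt_min => /andP[h1 h2].
have hw : cabs w / 2 <= cabs (w + h).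
  by have := cabsD (w + h) (- h); rewrite addrK cabsN; lra.
have wh0 : w + h != 0 by rewrite -cabs_gt0; apply: lt_le_trans hw; rewrite divr_gt0.
have -> : (w + h)^-1 - w^-1 - - w^-1 ^+ 2 * h = h ^+ 2 / (w ^+ 2 * (w + h)).
  by field; rewrite w0 wh0.
rewrite cabsM cabsV cabsM !cabsX ler_pdivrMr; last first.
  by rewrite mulr_gt0 ?exprn_gt0// cabs_gt0.
rewrite expr2 mulrAC ler_wpM2r ?cabs_ge0//.
apply: le_trans (ltW h2) _.
have -> : e * cabs w ^+ 3 / 2 = e * (cabs w ^+ 2 * (cabs w / 2)) by field.
by rewrite ler_pM2l// ler_pM2l// exprn_gt0.
Qed.

Lemma Re_sqrtc_ge0 (w : R[i]) : 0 <= complex.Re (sqrtc w).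
Proof. by case: w => a b; exact: sqrtr_ge0. Qed.

Lemma Re_sqr (s : R[i]) : complex.Re (s ^+ 2) = complex.Re s ^+ 2 - complex.Im s ^+ 2.
Proof. by case: s => a b /=; rewrite !expr2. Qed.

Lemma Im_sqr (s : R[i]) : complex.Im (s ^+ 2) = 2 * complex.Re s * complex.Im s.
Proof. by case: s => a b /=; rewrite (mulrC b) -mulrA -mulr2n mulr_natl. Qed.

Lemma Re_sqrtc_gt0 (w : R[i]) : 0 < complex.Re w -> 0 < complex.Re (sqrtc w).
Proof.
move=> w0; rewrite lt_neqAle Re_sqrtc_ge0 andbT eq_sym; apply/eqP => s0.
move: w0; rewrite -[w]sqr_sqrtc Re_sqr s0 expr0n sub0r.
by rewrite oppr_gt0 ltNge sqr_ge0.
Qed.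

(** With [h = (t - s)(t + s)] the remainder is [-(t - s)^2 / (2 s)]. Since [Re t >= 0], both
    [|t + s|] and [|s|] are at least [Re s > 0], which makes the remainder small against [|h|]. *)
Lemma cderivable_sqrtc (w : R[i]) : 0 < complex.Re w -> cderivable (@sqrtc R) w.
Proof.
move=> /Re_sqrtc_gt0; set s := sqrtc w => s0.
have sn0 : s != 0 by rewrite -cabs_gt0; apply: lt_le_trans (ler_Re_cabs s); rewrite gtr0_norm.
exists (2 * s)^-1 => e e0; exists (e * (2 * complex.Re s ^+ 3)); split.
  by rewrite !mulr_gt0// exprn_gt0.
move=> h hh; set t := sqrtc (w + h).
have t0 : 0 <= complex.Re t by exact: Re_sqrtc_ge0.
have hE : h = (t - s) * (t + s).
  by rewrite -subr_sqr !sqr_sqrtc addrC addKr.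
have ts : complex.Re s <= cabs (t + s).
  by apply: le_trans (ler_Re_cabs _); rewrite ReD ger0_norm ?addr_ge0 ?(ltW s0)// lerDr.
have ss : complex.Re s <= cabs s by apply: le_trans (ler_Re_cabs _); rewrite ler_norm.
have ts0 : 0 < cabs (t + s) by exact: lt_le_trans ts.
have -> : t - s - (2 * s)^-1 * h = - ((t - s) ^+ 2 / (2 * s)).
  by rewrite hE; field.
have c2 : cabs (2 : R[i]) = 2 by rewrite -(rmorph_nat (real_complex R)) cabsR normr_nat.
rewrite cabsN cabsM cabsV cabsX cabsM c2 ler_pdivrMr ?mulr_gt0 ?cabs_gt0//.
move: hh; rewrite hE cabsM => hh.
set x := cabs (t - s) in hh *; set y := cabs (t + s) in ts ts0 hh *.
set p := complex.Re s in s0 ts ss hh *; set q := cabs s in ss *.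
have x0 : 0 <= x by exact: cabs_ge0.
have y0 : 0 < y by [].
rewrite expr2.
have -> : e * (x * y) * (2 * q) = x * (e * y * (2 * q)) by ring.
rewrite ler_wpM2l//.
rewrite -(ler_pM2r y0); apply: le_trans (ltW hh) _.
have -> : e * y * (2 * q) * y = e * (2 * (q * (y * y))) by ring.
rewrite ler_pM2l// ler_pM2l// exprS expr2.
apply: ler_pM => //; rewrite ?mulr_ge0 ?(ltW s0)//.
by apply: ler_pM => //; rewrite ltW.
Qed.

End Holomorphy.

(** * Square roots, Orlicz functions and test functions *)

Section IteratedSqrt.
Variable R : realType.
Implicit Types w s : R[i].

Lemma Re_iter_sqrtc_gt0 m w : 0 < complex.Re w -> 0 < complex.Re (iter m (@sqrtc R) w).
Proof. by move=> w0; elim: m => //= m IH; exact: Re_sqrtc_gt0. Qed.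

Lemma iter_sqrtcX m w : iter m (@sqrtc R) w ^+ (2 ^ m) = w.
Proof.
by elim: m => [|m IH]; rewrite ?expn0 ?expr1// expnS exprM /= sqr_sqrtc.
Qed.

(* Each square root halves the slope of the sector [`|Im s| <= t * Re s]. *)
Lemma iter_sqrtc_sector m w : 0 < complex.Re w ->
  `|complex.Im (iter m.+1 (@sqrtc R) w)| <= (2 ^+ m)^-1 * complex.Re (iter m.+1 (@sqrtc R) w).
Proof.
move=> w0; elim: m => [|m IH].
  have s0 := Re_sqrtc_gt0 w0; rewrite /= expr0 invr1 mul1r.
  rewrite -(ger0_norm (ltW s0)) -ler_sqr ?nnegrE// !real_normK ?num_real//.
  by rewrite -subr_ge0 -Re_sqr sqr_sqrtc ltW.
move: IH; have := Re_iter_sqrtc_gt0 m.+1 w0; rewrite [iter m.+2 _ _]iterS.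
set v := iter m.+1 _ w; clearbody v => v0 IH.
have s0 := Re_sqrtc_gt0 v0.
set s := sqrtc v in s0 *; set t := (2 ^+ m)^-1 in IH.
have t0 : 0 < t by rewrite invr_gt0 exprn_gt0.
rewrite exprS invfM -/t -(ler_pM2l s0).
have : `|complex.Im v| <= t * complex.Re s ^+ 2.
  apply: le_trans IH _; rewrite ler_pM2l// -[v]sqr_sqrtc Re_sqr.
  by rewrite gerBl sqr_ge0.
rewrite -[v]sqr_sqrtc Im_sqr -/s !normrM (gtr0_norm s0) normr_nat expr2.
move: (complex.Re s) `|complex.Im s| => x y.
by lra.
Qed.

Lemma cabs_iter_sqrtc_le2 m w : cabs w <= 2 -> cabs (iter m (@sqrtc R) w) <= 2.
Proof.
move=> w2; elim: m => //= m IH; set s := sqrtc _.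
have : cabs s ^+ 2 <= 2 by rewrite -cabsX sqr_sqrtc.
by have := cabs_ge0 s; rewrite expr2; nra.
Qed.

(** With [s] the iterated root, [1 - l = k s], and after division by [k] the claim reads
    [|s| < b Re s - (b k / 2) |s|^2]. A narrow sector gives [|s| <= (1 + t0) Re s]; since
    [|s| <= 2], a small [k] absorbs the quadratic term. *)
Lemma koranyi_sector (b : R) : 1 < b -> exists (m : nat) (k : R), 0 < k /\
  forall w, cabs w < 1 ->
    let l := 1 - (k%:C)%C * iter m.+1 (@sqrtc R) (1 - w) in
    cabs (1 - l) < b / 2 * (1 - cabs l ^+ 2).
Proof.
move=> b1.
(* The aperture costs [b t0 = (b - 1)/2] and the quadratic term [b k = (b - 1)/4]: together less
   than the available [b - 1]. *)
pose t0 := (b - 1) / (2 * b).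
have b0 : 0 < b by lra.
have t00 : 0 < t0 by rewrite divr_gt0 ?mulr_gt0// subr_gt0.
have [m tm] : exists m : nat, (2 ^+ m)^-1 < t0.
  exists (Num.bound t0^-1); rewrite invf_plt ?posrE ?exprn_gt0//.
  apply: lt_trans (archi_boundP _) _; first by rewrite invr_ge0 ltW.
  by rewrite -natrX ltr_nat ltn_expl.
pose k := (b - 1) / (4 * b).
have k0 : 0 < k by rewrite divr_gt0 ?mulr_gt0// subr_gt0.
exists m, k; split => // w w1.
have rw : 0 < complex.Re (1 - w).
  rewrite ReD ReN /=; have := ler_Re_cabs w; rewrite ler_norml => /andP[_ ?].
  by lra.
have w2 : cabs (1 - w) <= 2.
  by apply: le_trans (cabsD _ _) _; rewrite cabsN cabsE Normc.normc1; lra.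
have := iter_sqrtc_sector m rw; have := Re_iter_sqrtc_gt0 m.+1 rw.
have := cabs_iter_sqrtc_le2 m.+1 w2.
move: (iter m.+1 _ _) => s s2 s0 hs /=.
rewrite (_ : 1 - (1 - _) = (k%:C)%C * s); last by ring.
have cs : cabs s <= (1 + t0) * complex.Re s.
  apply: le_trans (cabs_le s) _; rewrite mulrDl mul1r gtr0_norm// lerD2l.
  by apply: le_trans hs _; rewrite ler_pM2r// ltW.
rewrite sqr_cabs cabsM cabsR gtr0_norm//.
rewrite ReD ImD ReN ImN ReZ ImZ /=.
rewrite (_ : b / 2 * _ = k * (b * complex.Re s - b * k / 2 * cabs s ^+ 2)); last first.
  by rewrite sqr_cabs; field.
rewrite ltr_pM2l//.
have bk : b * k = (b - 1) / 4 by rewrite /k; field; rewrite gt_eqF.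
have bt : b * t0 = (b - 1) / 2 by rewrite /t0; field; rewrite gt_eqF.
have c0 : 0 <= cabs s by exact: cabs_ge0.
have c2 : cabs s ^+ 2 <= 2 * cabs s by rewrite expr2 ler_wpM2r.
rewrite bk.
apply: (@lt_le_trans _ _ (b * complex.Re s - (b - 1) / 4 / 2 * (2 * cabs s))); last first.
  by rewrite lerD2l lerN2 ler_wpM2l// !divr_ge0//; lra.
set p := complex.Re s in s0 cs *; set q := cabs s in cs *.
suff : (1 + (b - 1) / 4) * q < b * p by lra.
apply: (@le_lt_trans _ _ ((1 + (b - 1) / 4) * ((1 + t0) * p))).
  by rewrite ler_wpM2l//; lra.
rewrite mulrA ltr_pM2r//.
suff : t0 * (1 + (b - 1) / 4) < 3 / 4 * (b - 1) by lra.
have : t0 * (1 + (b - 1) / 4) <= t0 * b by rewrite ler_wpM2l ?(ltW t00)//; lra.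
by rewrite [t0 * b]mulrC bt; lra.
Qed.

End IteratedSqrt.

(** * Growth of Orlicz functions and the iterated Delta^2-condition *)

Section OrliczFunction.
Variables (R : realType) (psi : R -> R).
Hypothesis opsi : orlicz psi.

Lemma orlicz_ge0 x : 0 <= x -> 0 <= psi x.
Proof. by case: opsi => _ + _ _ _; exact. Qed.

(** Convexity on the segment from [0] to [y], with [psi 0 = 0]. The degenerate cases, which the
    strict inequality excludes, are treated apart. *)
Lemma orlicz_scale t y : 0 <= t <= 1 -> 0 <= y -> psi (t * y) <= t * psi y.
Proof.
case: opsi => psi0 _ cvx _ _ /andP[t0 t1] y0.
have [->|yn0] := eqVneq y 0; first by rewrite mulr0 psi0 mulr0.
have [->|tn0] := eqVneq t 0; first by rewrite !mul0r psi0.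
have [->|tn1] := eqVneq t 1; first by rewrite !mul1r.
have := cvx y 0 t y0 (lexx 0) yn0; rewrite psi0 !mulr0 !addr0 => /(_ _)/ltW; apply.
by rewrite !lt_neqAle eq_sym tn0 t0 tn1 t1.
Qed.

Lemma orlicz_homo x y : 0 <= x <= y -> psi x <= psi y.
Proof.
move=> /andP[x0 xy]; have y0 := le_trans x0 xy.
have [y00|yn0] := eqVneq y 0.
  by move: xy; rewrite y00 => xy; rewrite (@le_anti _ _ x 0)// xy x0.
have yp : 0 < y by rewrite lt_neqAle eq_sym yn0.
rewrite -[x](divfK yn0); apply: le_trans (orlicz_scale _ y0) _.
  by rewrite divr_ge0// ler_pdivrMr// mul1r.
by rewrite ler_piMl ?orlicz_ge0// ler_pdivrMr// mul1r.
Qed.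

Lemma orlicz_unbounded M : exists x0 : R, forall x, x0 < x -> M < psi x.
Proof.
case: opsi => _ _ _ _ /(_ `|M|)[x0 hx0]; exists (Num.max x0 1) => x.
rewrite gt_max => /andP[/hx0 + x1]; have xp : 0 < x by lra.
rewrite ltr_pdivlMr// => /(le_lt_trans _); apply.
apply: le_trans (ler_norm _) _; apply: ler_peMr => //; exact: ltW.
Qed.

(** Each use of the condition squares the left side and multiplies the argument by [C]. Replacing
    the given constant by its maximum with [1] keeps the argument above [x0], so the condition can
    be applied again. *)
Lemma delta2_iter : delta2 psi -> exists (C x0 : R), [/\ 1 <= C, 0 < x0 &
  forall j x, x0 <= x -> psi x ^+ (2 ^ j) <= psi (C ^+ j * x)].
Proof.
move=> [C0 [x0 [C00 [x00 h]]]].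
exists (Num.max 1 C0), x0; split => //; first by rewrite le_max lexx.
set C := Num.max 1 C0.
have C1 : 1 <= C by rewrite le_max lexx.
elim=> [|j IH] x hx; first by rewrite expn0 expr1 expr0 mul1r.
have x_gt0 : 0 < x by exact: lt_le_trans hx.
have Cx : x0 <= C ^+ j * x.
  by apply: le_trans hx _; rewrite ler_peMl ?exprn_ege1// ltW.
rewrite expnSr exprM; apply: (@le_trans _ _ (psi (C ^+ j * x) ^+ 2)).
  rewrite ler_sqr ?nnegrE ?IH// ?exprn_ge0 ?orlicz_ge0 ?(ltW x_gt0)//.
  by rewrite (le_trans _ Cx)// ltW.
apply: le_trans (h _ Cx) _; apply: orlicz_homo; apply/andP; split.
  by rewrite mulr_ge0 ?(ltW C00)// (le_trans _ Cx)// ltW.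
rewrite exprS -mulrA ler_wpM2r ?(le_trans _ Cx) ?(ltW x00)//.
by rewrite le_max lexx orbT.
Qed.

End OrliczFunction.

(** * The kernels peaking at [zeta] and their Hardy-Orlicz norms *)

Section TestFunctions.
Variables (R : realType) (N : nat) (zeta : cvec R N).
Hypothesis zeta1 : cnorm zeta = 1.

Lemma sqr_cnorm (z : cvec R N) :
  cnorm z ^+ 2 = \sum_(i < N) (complex.Re (z i) ^+ 2 + complex.Im (z i) ^+ 2).
Proof. by rewrite sqr_sqrtr//; apply: sumr_ge0 => i _; rewrite addr_ge0 ?sqr_ge0. Qed.

(** Summing [2 x y <= x^2 + y^2] over the coordinates replaces the Cauchy-Schwarz inequality; the
    bound is still below [1] inside the ball. *)
Lemma cdot_bound (z : cvec R N) :
  complex.Re (cdot z zeta) <= (cnorm z ^+ 2 + 1) / 2 /\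
  `|complex.Im (cdot z zeta)| <= (cnorm z ^+ 2 + 1) / 2.
Proof.
have -> : cnorm z ^+ 2 + 1 = cnorm z ^+ 2 + cnorm zeta ^+ 2 by rewrite zeta1 expr1n.
rewrite !sqr_cnorm -big_split mulr_suml /cdot.
rewrite (big_morph _ (@ReD R) (erefl _)) (big_morph _ (@ImD R) (erefl _)).
split; last apply: (le_trans (ler_norm_sum _ _ _)); apply: ler_sum => i _.
  case: (z i) (zeta i) => a b [c d] /=.
  by have := sqr_ge0 (a - c); have := sqr_ge0 (b - d); rewrite !expr2; lra.
case: (z i) (zeta i) => a b [c d] /=; rewrite ler_norml; apply/andP; split.
  by have := sqr_ge0 (a - d); have := sqr_ge0 (b + c); rewrite !expr2; lra.
by have := sqr_ge0 (a + d); have := sqr_ge0 (b - c); rewrite !expr2; lra.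
Qed.

Definition test_fun (A h : R) (z : cvec R N) : R[i] :=
  ((A * h)%:C)%C * ((1 + h)%:C%C - cdot z zeta)^-1.

Lemma Re_test_den (h : R) z : cnorm z < 1 -> 0 < h ->
  0 < complex.Re ((1 + h)%:C%C - cdot z zeta).
Proof.
move=> z1 h0; rewrite ReD ReN /=.
have [+ _] := cdot_bound z.
have : cnorm z ^+ 2 < 1 by rewrite expr_lt1 ?cnorm_ge0.
by lra.
Qed.

Lemma holo_test_fun (A h : R) : 0 < h -> holo_on_ball (test_fun A h).
Proof.
move=> h0 z z1.
have den0 : (1 + h)%:C%C - cdot z zeta != 0.
  by apply/eqP => e; have := Re_test_den z1 h0; rewrite e /= ltxx.
have hd : holo_at (fun z => (1 + h)%:C%C - cdot z zeta) z.
  apply: (eq_holo_at _ (holo_at_comp (holo_at_cdot zeta z)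
    (cderivable_affine (1 + h)%:C%C (-1) (cdot z zeta)))).
  by move=> u /=; rewrite mulN1r.
apply: (eq_holo_at _ (holo_at_comp (holo_at_comp hd (cderivable_inv den0))
  (cderivable_affine 0 ((A * h)%:C)%C _))).
by move=> u /=; rewrite add0r.
Qed.

Lemma cabs_test_fun (A h : R) z : 0 <= A -> 0 < h ->
  cabs (test_fun A h z) = A * (h / cabs ((1 + h)%:C%C - cdot z zeta)).
Proof.
by move=> A0 h0; rewrite cabsM cabsV cabsR ger0_norm ?mulr_ge0 ?(ltW h0)// mulrA.
Qed.

(** Uniform in [r]. The real part of the denominator is at least [1 + h - r], which exceeds [h]; the
    imaginary part is [r |Im <w, zeta>|] in modulus. The second bound uses the imaginary part for
    [r >= 1/2], and otherwise the real part, then above [1/2]. *)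
Lemma test_kernel_bound (h r : R) w : 0 < h -> 0 < r < 1 -> cnorm w <= 1 ->
  h <= cabs ((1 + h)%:C%C - cdot (rscale r w) zeta) /\
  `|complex.Im (cdot w zeta)| / 2 <= cabs ((1 + h)%:C%C - cdot (rscale r w) zeta).
Proof.
move=> h0 /andP[r0 r1] w1.
have w2 : cnorm w ^+ 2 <= 1 by rewrite expr_le1 ?cnorm_ge0.
have -> : cdot (rscale r w) zeta = (r%:C)%C * cdot w zeta.
  by rewrite /cdot mulr_sumr; apply: eq_bigr => i _; rewrite /rscale mulrA.
have [hR hI] := cdot_bound w.
have := ler_Re_cabs ((1 + h)%:C%C - (r%:C)%C * cdot w zeta).
have := ler_Im_cabs ((1 + h)%:C%C - (r%:C)%C * cdot w zeta).
rewrite ReD ImD ReN ImN ReZ ImZ /= add0r normrN normrM (gtr0_norm r0).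
move: (complex.Re _) (complex.Im _) hR hI (cabs _) => x y hR hI q hIq hRq.
have {}hRq : 1 + h - r * x <= q by apply: le_trans hRq; exact: ler_norm.
have rx : r * x <= r * 1 by rewrite ler_pM2l//; lra.
split; first by lra.
have [r2|r2] := lerP (1 / 2) r; last by lra.
apply: le_trans hIq; rewrite mulrC ler_wpM2r//.
by lra.
Qed.

(** With [M = K + 1] and [t = h / |denominator| <= 1], convexity gives
    [psi(A t / M) <= t psi(A) / M]. As [h = dl^2], [t <= dl] off the slab [|Im <w, zeta>| <= 2 dl],
    so the integral is at most [(psi(A) / M) K dl = K / M < 1]. *)
Lemma hnorm_test_fun (psi : R -> R) : orlicz psi -> exists M : R, 0 < M /\
  forall A : R, 0 <= A -> 1 <= psi A ->
    (hnorm psi (test_fun A ((psi A)^-1 ^+ 2)) <= M%:E)%E.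
Proof.
move=> opsi; have [K [K0 HK]] := sphere_slab zeta1.
exists (K + 1); split => [|A A0 A1]; first by rewrite ltr_wpDl.
have M0 : 0 < K + 1 by rewrite ltr_wpDl.
have psiA : 0 < psi A by lra.
set dl := (psi A)^-1; have dl0 : 0 < dl by rewrite invr_gt0.
have h0 : 0 < dl ^+ 2 by rewrite exprn_gt0.
apply: hnorm_le => // r r01.
pose a := psi A / (K + 1).
have a0 : 0 <= a by rewrite divr_ge0 // ltW.
apply: (@sphere_int_mono _ _ _ (fun w => (if cnorm w <= 1 then
    psi (cabs (dil (test_fun A (dl ^+ 2)) r w) / (K + 1)) else 0)%:E)).
- by move=> w; rewrite lee_fin orlicz_ge0// divr_ge0 ?cabs_ge0// ltW.
- by move=> w ->.
have -> : (1 = 1%:E :> \bar R)%E by [].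
apply: (@le_trans _ _ (a * (K * dl))%:E); last first.
  rewrite lee_fin /a /dl (_ : _ * _ = K / (K + 1)); last by field; rewrite !gt_eqF.
  by rewrite ler_pdivrMr// mul1r lerDl.
apply: (HK a dl a0 (ltW dl0)) => w.
  by case: ifP => // _; rewrite orlicz_ge0// divr_ge0 ?cabs_ge0// ltW.
move=> w1; rewrite w1 /dil cabs_test_fun//.
have [q1 q2] := test_kernel_bound h0 r01 w1.
move: (cabs _) q1 q2 => q q1 q2.
have q0 : 0 < q by exact: lt_le_trans q1.
set t := dl ^+ 2 / q.
have t0 : 0 <= t by rewrite divr_ge0 ?ltW.
have t1 : t <= 1 by rewrite ler_pdivrMr// mul1r.
rewrite (_ : A * t / (K + 1) = t / (K + 1) * A); last by rewrite -mulrA mulrC.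
apply: le_trans (orlicz_scale opsi _ A0) _.
  by rewrite divr_ge0 ?(ltW M0)//= ler_pdivrMr// mul1r (le_trans t1)// lerDr.
rewrite (_ : _ * psi A = a * t); last by rewrite /a; ring.
rewrite ler_wpM2l//; have [hle|hlt] /= := leP `|complex.Im (cdot w zeta)| (2 * dl).
  by rewrite (le_trans t1)// lerDr ltW.
rewrite addr0 /t ler_pdivrMr// expr2 ler_pM2l//.
by lra.
Qed.

End TestFunctions.

(** * The symbol and its compositions with the kernels *)

Section Symbol.
Variables (R : realType) (N : nat) (zeta : cvec R N).
Hypotheses (N0 : (0 < N)%N) (zeta1 : cnorm zeta = 1).

Lemma cnorm_cscale (c : R[i]) : cnorm (fun j => c * zeta j) = cabs c.
Proof.
rewrite /cnorm (eq_bigr (fun i => cabs c ^+ 2 *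
    (complex.Re (zeta i) ^+ 2 + complex.Im (zeta i) ^+ 2))); last first.
  by move=> i _; rewrite -!sqr_cabs cabsM exprMn.
rewrite -mulr_sumr sqrtrM ?sqr_ge0// sqrtr_sqr ger0_norm ?cabs_ge0//.
by rewrite -[Num.sqrt _]/(cnorm zeta) zeta1 mulr1.
Qed.

Lemma cdot_cscale (c : R[i]) : cdot (fun j => c * zeta j) zeta = c.
Proof.
rewrite /cdot (eq_bigr (fun i => c *
    ((complex.Re (zeta i) ^+ 2 + complex.Im (zeta i) ^+ 2)%:C)%C)); last first.
  move=> i _; rewrite -mulrA; congr (_ * _); case: (zeta i) => a b /=.
  by apply/eqP; rewrite eq_complex /=; apply/andP; split; apply/eqP; ring.
by rewrite -mulr_sumr -rmorph_sum -sqr_cnorm zeta1 expr1n mulr1.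
Qed.

Variables (m : nat) (k : R).

Definition lens (w : R[i]) : R[i] := 1 - (k%:C)%C * iter m.+1 (@sqrtc R) (1 - w).

Definition symbol (z : cvec R N) : cvec R N := fun j => lens (z (Ordinal N0)) * zeta j.

Lemma holo_at_iter_sqrtc n (f : cvec R N -> R[i]) z : holo_at f z ->
  0 < complex.Re (f z) -> holo_at (fun z => iter n (@sqrtc R) (f z)) z.
Proof.
move=> hf f0; elim: n => //= n IH.
exact: holo_at_comp IH (cderivable_sqrtc (Re_iter_sqrtc_gt0 _ f0)).
Qed.

Lemma holo_lens z : cnorm z < 1 -> holo_at (fun z : cvec R N => lens (z (Ordinal N0))) z.
Proof.
move=> z1.
have h1 : holo_at (fun z : cvec R N => 1 - z (Ordinal N0)) z.
  apply: (eq_holo_at _ (holo_at_comp (holo_at_coord (Ordinal N0) z)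
    (cderivable_affine 1 (-1) _))).
  by move=> u /=; rewrite mulN1r.
have Re1 : 0 < complex.Re (1 - z (Ordinal N0)).
  rewrite ReD ReN /=.
  have := le_trans (ler_norm _) (ler_Re_cabs (z (Ordinal N0))).
  by have := ler_cabs_cnorm z (Ordinal N0); lra.
apply: (eq_holo_at _ (holo_at_comp (holo_at_iter_sqrtc m.+1 h1 Re1)
    (cderivable_affine 1 (- (k%:C)%C) _))).
by move=> u /=; rewrite mulNr.
Qed.

Lemma holo_map_symbol : holo_map symbol.
Proof.
move=> j z z1; apply: (@eq_holo_at _ _ _ (fun z => symbol z j) _ _ (holo_at_comp (holo_lens z1)
    (cderivable_affine 0 (zeta j) _))).
by move=> u /=; rewrite add0r mulrC.
Qed.

(** Since [<symbol u, zeta>] equals [lens] of the first coordinate, the composition depends on that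
    coordinate alone and the one-variable chain rule applies. *)
Lemma holo_test_symbol A h : 0 < h -> (forall z, cnorm z < 1 -> cnorm (symbol z) < 1) ->
  forall z, cnorm z < 1 -> holo_at (fun z => test_fun zeta A h (symbol z)) z.
Proof.
move=> h0 maps z z1.
have E u : test_fun zeta A h (symbol u) =
    (A * h)%:C%C * ((1 + h)%:C%C - lens (u (Ordinal N0)))^-1.
  by rewrite /test_fun cdot_cscale.
have den0 : (1 + h)%:C%C - lens (z (Ordinal N0)) != 0.
  apply/eqP => e; have := Re_test_den zeta1 (maps _ z1) h0.
  by rewrite cdot_cscale e ltxx.
have hd : holo_at (fun z : cvec R N => (1 + h)%:C%C - lens (z (Ordinal N0))) z.
  apply: (eq_holo_at _ (holo_at_comp (holo_lens z1)
    (cderivable_affine (1 + h)%:C%C (-1) _))).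
  by move=> u /=; rewrite mulN1r.
apply: (eq_holo_at _ (holo_at_comp (holo_at_comp hd (cderivable_inv den0))
  (cderivable_affine 0 ((A * h)%:C)%C _))).
by move=> u /=; rewrite add0r E.
Qed.

Hypothesis k0 : 0 < k.

Lemma cdot_symbol z : cdot (symbol z) zeta = lens (z (Ordinal N0)).
Proof. exact: cdot_cscale. Qed.

Lemma test_symbol_den h z : (1 + h)%:C%C - cdot (symbol z) zeta =
  h%:C%C + k%:C%C * iter m.+1 (@sqrtc R) (1 - z (Ordinal N0)).
Proof. by rewrite cdot_symbol /lens rmorphD rmorph1; ring. Qed.

Lemma le_test_symbol_den h z : 0 < h ->
  h <= cabs ((1 + h)%:C%C - cdot (symbol z) zeta).
Proof.
move=> h0; rewrite test_symbol_den.
apply: le_trans (ler_Re_cabs _); rewrite ReD ReZ [complex.Re _%:C%C]/=.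
have s0 : 0 <= complex.Re (iter m.+1 (@sqrtc R) (1 - z (Ordinal N0))) by exact: Re_sqrtc_ge0.
by rewrite ger0_norm ?addr_ge0 ?lerDl ?mulr_ge0 ?(ltW h0) ?(ltW k0).
Qed.

Lemma test_symbol_le A h z : 0 <= A -> 0 < h ->
  cabs (test_fun zeta A h (symbol z)) <= A.
Proof.
move=> A0 h0; rewrite cabs_test_fun//.
have hd := le_test_symbol_den z h0.
by rewrite ler_piMr// ler_pdivrMr ?mul1r// (lt_le_trans h0).
Qed.

(** Taking the [2^(m+1)]-th root of the hypothesis gives [k |s| <= h], so the denominator [h + k s]
    has modulus at most [2 h]. *)
Lemma test_symbol_ge A h z : 0 <= A -> 0 < h ->
  cabs (1 - z (Ordinal N0)) <= (h / k) ^+ (2 ^ m.+1) ->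
  A / 2 <= cabs (test_fun zeta A h (symbol z)).
Proof.
move=> A0 h0 hz; rewrite cabs_test_fun// test_symbol_den.
set s := iter m.+1 _ _.
have hk : 0 <= h / k by rewrite divr_ge0 ?ltW.
have sk : cabs s <= h / k.
  by rewrite -(@ler_pXn2r _ (2 ^ m.+1)) ?nnegrE ?cabs_ge0 ?expn_gt0// -cabsX iter_sqrtcX.
rewrite ler_wpM2l//.
have den : cabs (h%:C%C + k%:C%C * s) <= 2 * h.
  apply: le_trans (cabsD _ _) _; rewrite cabsM !cabsR !gtr0_norm//.
  by move: sk; rewrite ler_pdivlMr// => sk; lra.
have hd := le_test_symbol_den z h0; rewrite test_symbol_den -/s in hd.
by rewrite ler_pdivlMr ?(lt_le_trans h0)//; lra.
Qed.

End Symbol.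

(** * Non-compactness of the composition operator *)

Lemma cvge0_lt (R : realType) (u : nat -> \bar R) (e : R) : 0 < e ->
  u @ \oo --> 0%E -> exists K, forall n, (K <= n)%N -> (u n < e%:E)%E.
Proof.
move=> e0 /(_ [set y | (y < e%:E)%E])[].
  apply: open_nbhs_nbhs; split; last by rewrite /= lte_fin.
  exact: open_ereal_lt_ereal.
by move=> K _ HK; exists K.
Qed.

Theorem theorem3p5 (R : realType) (N : nat) (psi : R -> R) :
  (1 <= N)%N -> orlicz psi -> delta2 psi ->
  forall (zeta : cvec R N) (b : R), cnorm zeta = 1 -> 1 < b ->
  exists phi : cvec R N -> cvec R N,
    holo_map phi /\
    (forall z : cvec R N, cnorm z < 1 -> koranyi zeta b (phi z)) /\
    ~ comp_op_compact psi phi.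
Proof.
move=> N0 opsi d2 zeta b zeta1 b1.
have [m [k [k0 Hk]]] := koranyi_sector b1.
pose phi := symbol zeta N0 m k.
have kor z : cnorm z < 1 -> koranyi zeta b (phi z).
  move=> z1; have := Hk (z (Ordinal N0)) (le_lt_trans (ler_cabs_cnorm _ _) z1).
  rewrite /= -/(lens m k (z (Ordinal N0))) => h.
  rewrite /koranyi [cdot _ _]cdot_symbol// [cnorm _]cnorm_cscale//; split => //.
  (* The inequality itself forces [|l| < 1]: its left side is nonnegative, so [1 - |l|^2] is
     positive. *)
  rewrite -(@expr_lt1 _ 2) ?cabs_ge0// -subr_gt0 -(@pmulr_rgt0 _ (b / 2)) ?divr_gt0 ?(lt_trans _ b1)//.
  exact: le_lt_trans (cabs_ge0 _) h.
exists phi; split; first exact: holo_map_symbol.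
split => // -[_ cpt].
have [M [M0 HM]] := hnorm_test_fun zeta1 opsi.
have [c [c0 Hc]] := sphere_int_cover R N0.
have [C [x0 [C1 x00 HC]]] := delta2_iter opsi d2.
(* The cap used below has measure of order [psi(A)^(-2E)], with [c'] collecting the constants;
   [j = 2E + 1] leaves one factor [psi(A)] to spare. *)
pose E := (2 ^ m.+1 * (2 * N).-1)%N.
pose j := (2 * E).+1.
pose c' := c * (2^-1 * k^-1 ^+ (2 ^ m.+1)) ^+ (2 * N).-1.
have c'0 : 0 < c' by rewrite mulr_gt0// exprn_gt0// mulr_gt0 ?exprn_gt0 ?invr_gt0.
(* The three terms ensure [psi(A) >= 1], [h / k <= 1] and the final contradiction
   [psi(A) c' > 1]. *)
have [y hy] := orlicz_unbounded opsi (1 + k^-1 + c'^-1).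
pose A0 := `|y| + 1 + x0.
have yA0 : y < A0 by have := ler_norm y; rewrite /A0; lra.
have A00 : 0 < A0 by have := normr_ge0 y; rewrite /A0; lra.
(* With ratio [4], an earlier function is at most [A n2 / 4] where the later one is at least
   [A n2 / 2]. *)
pose A n : R := 4 ^+ n * A0.
have A0A n : A0 <= A n by rewrite ler_peMl ?(ltW A00)// exprn_ege1// ler1n.
have Apos n : 0 < A n by exact: lt_le_trans A00 _.
have psiA n : 1 + k^-1 + c'^-1 < psi (A n) by apply: hy; exact: lt_le_trans yA0 _.
have ki0 : 0 < k^-1 by rewrite invr_gt0.
have ci0 : 0 < c'^-1 by rewrite invr_gt0.
have psiA1 n : 1 <= psi (A n) by have := psiA n; lra.
pose h n := (psi (A n))^-1 ^+ 2.
have h0 n : 0 < h n by rewrite exprn_gt0// invr_gt0 (lt_le_trans ltr01).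
pose f n := test_fun zeta (A n) (h n).
have hnf n : (hnorm psi (f n) <= M%:E)%E by exact: HM (ltW (Apos n)) (psiA1 n).
have [n||sub [g [subh [[hg _] cv]]]] := cpt f.
- by split; [exact: holo_test_fun|exact: le_lt_trans (hnf n) (ltry _)].
- by exists M.
have Cj0 : 0 < C ^+ j by rewrite exprn_gt0// (lt_le_trans ltr01).
(* Dividing a value at least [A n2 / 8] by a norm below this threshold gives at least [C^j A n2]. *)
have e0 : 0 < (8 * C ^+ j)^-1 by rewrite invr_gt0 mulr_gt0.
have [K HK] := cvge0_lt e0 cv.
have n12 : (sub K < sub K.+1)%N by exact: subh.
have H1 := HK K (leqnn _); have H2 := HK K.+1 (leqnSn _).
move: (sub K) (sub K.+1) n12 H1 H2 => n1 n2 n12 H1 H2 {HK cv subh}.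
set X := psi (A n2); have X1 : 1 <= X by exact: psiA1.
have X0 : 0 < X by lra.
pose t := (h n2 / k) ^+ (2 ^ m.+1).
have hk0 : 0 < h n2 / k by rewrite divr_gt0.
have t0 : 0 < t by rewrite exprn_gt0.
have t1 : t <= 1.
  rewrite exprn_ile1 ?(ltW hk0)// ler_pdivrMr// mul1r /h -/X expr2.
  apply: (@le_trans _ _ X^-1).
    by rewrite ler_piMl ?invr_ge0 ?(ltW X0)// invf_le1.
  by rewrite invf_ple ?posrE//; have := psiA n2; rewrite -/X; lra.
(* Half of [t] pays for the radius [1 - eta] and half for the cap:
   [|1 - (1 - eta) w_0| <= eta + eta = t]. *)
pose eta := 2^-1 * t.
have eta01 : 0 < eta <= 1 by rewrite /eta; apply/andP; split; lra.
have r01 : 0 < 1 - eta < 1 by rewrite /eta; apply/andP; split; lra.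
have [c1 [c10 c1e I1]] := hnorm_lt H1 r01.
have [c2 [c20 c2e I2]] := hnorm_lt H2 r01.
pose D n (z : cvec R N) := f n (phi z) - g z.
have contD n : ball_continuous (fun z => cabs (D n z)).
  apply: ball_continuous_cabs => z z1; apply: holo_at_sub; last exact: hg.
  by apply: holo_test_symbol => // u /kor[].
have psi_mono n q : 0 < q -> (q%:E < ((8 * C ^+ j)^-1)%:E)%E ->
    forall w, A n2 / 8 <= cabs (D n (rscale (1 - eta) w)) ->
    psi (C ^+ j * A n2) <= psi (cabs (D n (rscale (1 - eta) w)) / q).
  move=> q0; rewrite lte_fin => qe w hw; apply: orlicz_homo => //.
  rewrite mulr_ge0 ?(ltW Cj0) ?(ltW (Apos _))//= ler_pdivlMr//.
  apply: le_trans hw; rewrite mulrAC mulrC ler_pM2l//.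
  have : q * (8 * C ^+ j) <= 1 by rewrite -ler_pdivlMr ?mul1r ?mulr_gt0// ltW.
  by lra.
have A10 := ltW (Apos n1); have A20 := ltW (Apos n2).
have A12 : A n1 <= A n2 / 4.
  rewrite ler_pdivlMr// mulrC /A mulrA -exprS ler_pM2r//.
  by rewrite ler_weXn2l// ler1n.
(* The two compositions differ by at least [A n2 / 4] at such points, so one of them is at distance
   at least [A n2 / 8] from [g]. *)
have cover w : cabs (1 - w (Ordinal N0)) <= eta ->
    A n2 / 8 <= cabs (D n1 (rscale (1 - eta) w)) \/
    A n2 / 8 <= cabs (D n2 (rscale (1 - eta) w)).
  move=> hw; set z := rscale _ w.
  have hz : cabs (1 - z (Ordinal N0)) <= t.
    rewrite /z /rscale.
    have -> : 1 - (1 - eta)%:C%C * w (Ordinal N0) =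
        eta%:C%C + (1 - eta)%:C%C * (1 - w (Ordinal N0)).
      by rewrite rmorphB rmorph1; ring.
    apply: le_trans (cabsD _ _) _; rewrite cabsM !cabsR !gtr0_norm; [|lra|lra].
    have : (1 - eta) * cabs (1 - w (Ordinal N0)) <= 1 * eta.
      by apply: ler_pM; rewrite ?cabs_ge0//; lra.
    by rewrite /eta; lra.
  have ge2 := test_symbol_ge zeta1 k0 A20 (h0 n2) hz.
  have le1 := test_symbol_le N0 zeta1 m k0 z A10 (h0 n1).
  have := cabsD (D n2 z) (- D n1 z); rewrite cabsN.
  have -> : D n2 z - D n1 z = f n2 (phi z) - f n1 (phi z) by rewrite /D; ring.
  have := cabs_sub (f n2 (phi z)) (f n1 (phi z)).
  rewrite ler_norml => /andP[_]; rewrite /f.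
  move: le1 ge2; rewrite -/phi -/(f _).
  case: (leP (A n2 / 8) (cabs (D n1 z))) => [|lt1]; first by left.
  by move=> le1 ge2 l1 l2; right; lra.
have Q0 (q : R) n w : 0 < q -> 0 <= psi (cabs (D n (rscale (1 - eta) w)) / q).
  by move=> q0; rewrite orlicz_ge0// divr_ge0 ?cabs_ge0// ltW.
have P0 : 0 <= psi (C ^+ j * A n2) by rewrite orlicz_ge0// mulr_ge0// ltW.
have fin := Hc eta (1 - eta) eta01 r01 _ _ _ _ (A n2 / 8) (psi (C ^+ j * A n2))
  (contD n1) (contD n2) P0 (fun w => Q0 _ n1 w c10) (fun w => Q0 _ n2 w c20) cover
  (psi_mono _ _ c10 c1e) (psi_mono _ _ c20 c2e) I1 I2.
have etaE : c * eta ^+ (2 * N).-1 = c' * X^-1 ^+ (2 * E).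
  have -> : eta = (2^-1 * k^-1 ^+ (2 ^ m.+1)) * X^-1 ^+ (2 * 2 ^ m.+1).
    by rewrite /eta /t exprMn /h -/X -exprM -mulrA (mulrC (k^-1 ^+ _)).
  by rewrite exprMn mulrA -exprM -mulnA.
have Xj : X ^+ j <= psi (C ^+ j * A n2).
  have xA : x0 <= A n2.
    by apply: le_trans (A0A n2); have := normr_ge0 y; rewrite /A0; lra.
  (* Here [j < 2^j] and [X >= 1]. *)
  by apply: le_trans (HC j _ xA); rewrite ler_weXn2l// ltnW// ltn_expl.
have : X ^+ j * (c' * X^-1 ^+ (2 * E)) <= 1.
  apply: le_trans fin; rewrite etaE ler_wpM2r// mulr_ge0 ?(ltW c'0)//.
  by rewrite exprn_ge0// invr_ge0 ltW.
(* The powers [X^(2E)] cancel, leaving [X c' <= 1] against the choice of [A0]. *)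
rewrite /j exprS exprVn (_ : X * _ * _ = X * c'); last first.
  by field; rewrite expf_neq0// gt_eqF.
rewrite -ler_pdivlMr// mul1r leNgt => /negP; apply.
by have := psiA n2; rewrite -/X; lra.
Qed.
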